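(* Let $\mathbb{K}$ be a computable field and $\mathcal{A}$ an $\omega$-well structured, well ordered and computable domain of variables. Then the problem Ideal-memb in $\mathbb{K}[\mathcal{A}]$ is decidable: given a polynomial $f\in\mathbb{K}[\mathcal{A}]$ and a finite set $\mathcal{B}\subseteq\mathbb{K}[\mathcal{A}]$, one can decide whether $f$ belongs to the equivariant ideal generated by $\mathcal{B}$.
   Context: A domain of variables $\mathcal{A}=(A,r_1,\dots,r_n)$ is a countable relational structure (equality always definable; definable = Boolean combination of the $r_i$). It is well ordered if some well order on $A$ is definable. Embeddings are maps $A\to A$ preserving and reflecting all relations; $\mathrm{Emb}(\mathcal{A})$ denotes them. $\omega$-well structured: the quasi order on labellings $\ell:B\to\mathbb{N}$ of finite $B\subseteq A$, given by $\ell\rightsquigarrow\ell'$ (with $\ell':B'\to\mathbb{N}$) iff some embedding $\iota$ satisfies $\iota(B)\subseteq B'$ and $\ell(b)\le\ell'(\iota(b))$ for $b\in B$, is a well quasi order. For finite $B\subseteq A$ let $\mathrm{Emb}_B=\{\iota|_B:\iota\in\mathrm{Emb}(\mathcal{A})\}$. $\mathcal{A}$ is computable if elements of $A$ are finitely represented and: (C1) given finite $B\subseteq A$ and $\pi:B\to A$ one can decide whether $\pi\in\mathrm{Emb}_B$; (C2) given finite $B,B'\subseteq A$ one can compute a finite $F\subseteq\mathrm{Emb}_B\times\mathrm{Emb}_{B'}$ such that every pair in $\mathrm{Emb}_B\times\mathrm{Emb}_{B'}$ equals $(\kappa\circ\pi,\kappa\circ\pi')$ for some $\kappa\in\mathrm{Emb}(\mathcal{A})$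 and $(\pi,\pi')\in F$. A computable field has finitely represented elements with computable field operations. $\mathbb{K}[\mathcal{A}]$ is the polynomial ring over $\mathbb{K}$ with variables the elements of $A$; embeddings act by renaming variables. The equivariant ideal generated by $\mathcal{B}$ is the set of all $\sum_i h_i\cdot\iota_i(g_i)$ with $g_i\in\mathcal{B}$, $h_i\in\mathbb{K}[\mathcal{A}]$, $\iota_i\in\mathrm{Emb}(\mathcal{A})$. *)

(* Defs.v *)
From HB Require Import structures.
From Stdlib Require Relation_Definitions.
From mathcomp Require Import all_boot all_order all_algebra.
From mathcomp Require Import finmap monalg wochoice.

Set Implicit Arguments.
Unset Strict Implicit.
Unset Printing Implicit Defensive.

Import GRing.Theory.
Local Open Scope ring_scope.

(* Computability is taken with respect to Kleene's mu-recursive functions.    *)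
(* Programs are not indexed by their arity: [Zero] accepts any input, and a   *)
(* program applied to an input it does not accept simply has no value.        *)
Inductive program : Type :=
| Zero
| Succ
| Proj of nat
| Comp of program & seq program
| PrimRec of program & program
| Mu of program.

(* [computes c v y]: on the input tuple v, the program c halts with value y.  *)
Inductive computes : program -> seq nat -> nat -> Prop :=
| computes_zero v : computes Zero v 0
| computes_succ n : computes Succ [:: n] n.+1
| computes_proj i v : (i < size v)%N -> computes (Proj i) v (nth 0%N v i)
| computes_comp c cs v ws y :
    computes_all cs v ws -> computes c ws y -> computes (Comp c cs) v y
| computes_rec0 c d v y :
    computes c v y -> computes (PrimRec c d) (0%N :: v) y
| computes_recS c d n v y z :
    computes (PrimRec c d) (n :: v) y -> computes d [:: n, y & v] z ->
    computes (PrimRec c d) (n.+1 :: v) z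
| computes_mu c v n (pos : nat -> nat) :
    (forall m, (m < n)%N -> computes c (m :: v) (pos m).+1) ->
    computes c (n :: v) 0 -> computes (Mu c) v n
with computes_all : seq program -> seq nat -> seq nat -> Prop :=
| computes_nil v : computes_all [::] v [::]
| computes_cons c cs v w ws :
    computes c v w -> computes_all cs v ws ->
    computes_all (c :: cs) v (w :: ws).

Scheme computes_mut := Induction for computes Sort Prop
  with computes_all_mut := Induction for computes_all Sort Prop.

Lemma computes_functional c v y y' :
  computes c v y -> computes c v y' -> y = y'.
Proof.
move=> cy; move: y'.
pose P c v y (_ : computes c v y) := forall y', computes c v y' -> y = y'.
pose Q cs v ws (_ : computes_all cs v ws) :=
  forall ws', computes_all cs v ws' -> ws = ws'.
apply: (@computes_mut P Q) cy; rewrite /P /Q; move: P Q => _ _; clear c v y.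
- by move=> v y' H; inversion H.
- by move=> n y' H; inversion H.
- by move=> i v lt_iv y' H; inversion H.
- move=> c cs v ws y _ IHs _ IH y' H; inversion H; subst.
  by apply: IH; rewrite (IHs ws0).
- by move=> c d v y _ IH y' H; inversion H; subst; apply: IH.
- move=> c d n v y z _ IH1 _ IH2 y' H; inversion H; subst.
  by apply: IH2; rewrite (IH1 y0).
- move=> c v n pos _ IHpos _ IH0 y' H; inversion H as [| | | | | |? ? ? pos' Hpos' H0']; subst.
  case: (ltngtP n y') => // lt_ny.
  + by have := IH0 _ (Hpos' _ lt_ny).
  + by have := IHpos _ lt_ny _ H0'.
- by move=> v ws' H; inversion H.
- move=> c cs v w ws _ IH _ IHs ws' H; inversion H; subst.
  by rewrite (IH w0) // (IHs ws0).
Qed.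

(* An element x of a countType is finitely represented by the number          *)
(* [choice.pickle x]; the pickle of a list is its code under the computable   *)
(* bijection between nat and seq nat of choice.v.  Programs are only required *)
(* to behave well on the inputs satisfying the promise D.                     *)
Definition decidable_on (T : countType) (D P : T -> Prop) : Prop :=
  exists c : program, forall x : T, D x ->
    (P x -> computes c [:: choice.pickle x] 1) /\ (~ P x -> computes c [:: choice.pickle x] 0).

Definition decidable_pred (T : countType) (P : T -> Prop) : Prop :=
  decidable_on (fun=> True) P.

Definition computable_on (T U : countType) (D : T -> Prop) (f : T -> U) : Prop :=
  exists c : program, forall x : T, D x -> computes c [:: choice.pickle x] (choice.pickle (f x)).

Definition computable (T U : countType) (f : T -> U) : Prop :=
  computable_on (fun=> True) f.

Definition computable_field (K : countFieldType) : Prop :=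
  [/\ computable (fun p : K * K => p.1 + p.2),
      computable (fun x : K => - x),
      computable (fun p : K * K => p.1 * p.2) &
      computable (fun x : K => x^-1)].

(* The countType structure of the carrier provides the finite representation  *)
(* of its elements.                                                           *)
Record rel_structure := RelStructure {
  carrier :> countType;
  nrel : nat;
  arity : 'I_nrel -> nat;
  interp : forall i : 'I_nrel, (arity i).-tuple carrier -> Prop }.

Section Domain.

Variable A : rel_structure.

Inductive qf_formula (k : nat) : Type :=
| QfRel (i : 'I_(nrel A)) of (arity i).-tuple 'I_k
| QfEq of 'I_k & 'I_k
| QfNot of qf_formula k
| QfAnd of qf_formula k & qf_formula k
| QfOr of qf_formula k & qf_formula k.

Fixpoint qf_holds k (phi : qf_formula k) (v : k.-tuple A) : Prop :=
  match phi with
  | QfRel i t => interp (map_tuple (tnth v) t)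
  | QfEq x y => tnth v x = tnth v y
  | QfNot phi1 => ~ qf_holds phi1 v
  | QfAnd phi1 phi2 => qf_holds phi1 v /\ qf_holds phi2 v
  | QfOr phi1 phi2 => qf_holds phi1 v \/ qf_holds phi2 v
  end.

Definition definable k (P : k.-tuple A -> Prop) : Prop :=
  exists phi : qf_formula k, forall v, P v <-> qf_holds phi v.

Definition well_ordered : Prop :=
  exists2 R : rel A, well_order R &
    definable (fun v : 2.-tuple A => R (tnth v ord0) (tnth v ord_max)).

(* Equality counts as one of the relations, whence injectivity.               *)
Definition embedding (iota : A -> A) : Prop :=
  injective iota /\
  forall i (t : (arity i).-tuple A), interp (map_tuple iota t) <-> interp t.

(* A labelling B -> N of a finite B is a finite map with domain B.            *)
Definition labelling_le (l l' : {fmap A -> nat}) : Prop :=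
  exists2 iota, embedding iota &
    forall b n, l.[? b]%fmap = Some n ->
      exists2 n', l'.[? iota b]%fmap = Some n' & (n <= n')%N.

Definition well_quasi_order T (R : T -> T -> Prop) : Prop :=
  Relation_Definitions.preorder T R /\
  forall s : nat -> T, exists i j : nat, (i < j)%N /\ R (s i) (s j).

Definition omega_well_structured : Prop := well_quasi_order labelling_le.

(* A finite B is represented by a duplicate-free list of its elements, and a  *)
(* map pi : B -> A by the list s of the values of pi along that list.         *)
Definition in_emb (B s : seq A) : Prop :=
  exists2 iota, embedding iota & s = map iota B.

Definition emb_decidable : Prop :=
  decidable_on (fun Bs : seq A * seq A => uniq Bs.1 /\ size Bs.2 = size Bs.1)
               (fun Bs => in_emb Bs.1 Bs.2).

Definition emb_pairs_basis (B B' : seq A) (F : seq (seq A * seq A)) : Prop :=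
  (forall p, p \in F -> in_emb B p.1 /\ in_emb B' p.2) /\
  (forall s s', in_emb B s -> in_emb B' s' ->
     exists2 kappa, embedding kappa &
       exists2 p, p \in F & s = map kappa p.1 /\ s' = map kappa p.2).

Definition emb_pairs_computable : Prop :=
  exists2 F : seq A * seq A -> seq (seq A * seq A),
    computable_on (fun BB => uniq BB.1 /\ uniq BB.2) F &
    forall B B', uniq B -> uniq B' -> emb_pairs_basis B B' (F (B, B')).

Definition computable_domain : Prop := emb_decidable /\ emb_pairs_computable.

End Domain.

Section PolynomialRing.

Variables (I : choiceType) (K : fieldType).

Local Notation polyring := {malg K[{cmonom I}]}.

Definition pvar (x : I) : polyring := << ucm x >>.

Definition rename (iota : I -> I) (p : polyring) : polyring :=
  mmap (fun c : K => c%:MP)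
       (fun m : {cmonom I} => \prod_(x <- finsupp m) pvar (iota x) ^+ m x) p.

(* Polynomials are represented by lists of terms, a term being a coefficient  *)
(* together with a list of powers of variables; a polynomial has many         *)
(* representations.                                                           *)
Definition poly_of (p : seq (K * seq (I * nat))) : polyring :=
  \sum_(t <- p) t.1 *: \prod_(xe <- t.2) pvar xe.1 ^+ xe.2.

Lemma monalgUM (c1 c2 : K) (m1 m2 : {cmonom I}) :
  << c1 *g m1 >> * << c2 *g m2 >> = << c1 * c2 *g mmul m1 m2 >> :> polyring.
Proof. by rewrite malgM_def fgmulUU. Qed.

Lemma monalgUM1 (m1 m2 : {cmonom I}) :
  << m1 >> * << m2 >> = << mmul m1 m2 >> :> polyring.
Proof. by rewrite monalgUM (mulr1 (1 : K)). Qed.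

Lemma prod_pvar (m : {cmonom I}) :
  \prod_(x <- finsupp m) pvar x ^+ m x = << m >> :> polyring.
Proof.
have pvarX x n : exists2 m' : {cmonom I}, pvar x ^+ n = << m' >> &
    forall y, m' y = ((x == y) * n)%N.
  elim: n => [|n [m' Em' m'E]].
    by exists mone => [|y]; rewrite ?expr0 // cm1 muln0.
  exists (mmul (ucm x) m') => [|y]; last by rewrite cmM cmU m'E mulnS.
  by rewrite exprS Em'; apply: monalgUM1.
have prodE (s : seq I) : uniq s -> exists2 m' : {cmonom I},
    \prod_(x <- s) pvar x ^+ m x = << m' >> &
    forall y, m' y = if y \in s then m y else 0%N.
  elim: s => [_|x s IHs /= /andP[xs /IHs[m' Em' m'E]]].
    by exists mone => [|y]; rewrite ?big_nil // cm1.
  have [mx Emx mxE] := pvarX x (m x).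
  exists (mmul mx m') => [|y].
    by rewrite big_cons [X in X * _]Emx Em'; apply: monalgUM1.
  rewrite cmM mxE m'E inE [y == x]eq_sym.
  case: (eqVneq x y) => [<-|neq_xy] /=; last by rewrite mul0n.
  by rewrite (negPf xs) mul1n addn0.
have [m' -> m'E] := prodE _ (fset_uniq (finsupp m)).
congr (<< _ >>); apply/eqP/cmP => y; rewrite m'E.
by case: mdomP.
Qed.

Lemma poly_of_surj (f : polyring) : exists p, poly_of p = f.
Proof.
exists [seq (f@_m, [seq (x, m x) | x <- finsupp m]) | m : {cmonom I} <- msupp f].
rewrite /poly_of big_map [RHS]monalgE; apply: eq_bigr => m _ /=.
rewrite big_map prod_pvar -mul_malgC monalgUM mul1m (mulr1 f@_m); reflexivity.
Qed.

End PolynomialRing.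

Definition equivariant_ideal (A : rel_structure) (K : fieldType)
    (B : {malg K[{cmonom A}]} -> Prop) (f : {malg K[{cmonom A}]}) : Prop :=
  exists n (h g : 'I_n -> {malg K[{cmonom A}]}) (iota : 'I_n -> A -> A),
    [/\ forall i, B (g i),
        forall i, embedding (iota i) &
        f = \sum_(i < n) h i * rename (iota i) (g i)].

(* An instance of the problem consists of a polynomial and a list of          *)
(* generators, all given by representations.                                  *)
Definition ideal_memb (A : rel_structure) (K : countFieldType)
    (fB : seq (K * seq (A * nat)) * seq (seq (K * seq (A * nat)))) : Prop :=
  equivariant_ideal (fun g => exists2 p, p \in fB.2 & g = poly_of p)
                    (poly_of fB.1).

(* Main.v *)
(* A polynomial is kept as a list of terms whose monomials are words of        *)
(* variables up to permutation.  Words are compared lexicographically from the *)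
(* largest variable down.  Embeddings are strictly monotone for this order and *)
(* never make a word smaller, so that omega-well structuredness both makes the *)
(* order well founded and gives Dickson's lemma up to embedding.  Starting     *)
(* from the generators, one repeatedly adds all S-polynomials of the pairs     *)
(* listed by (C2).  The union of these bases is closed under S-polynomials,    *)
(* hence is an equivariant Groebner basis, and by Dickson's lemma a finite     *)
(* stage already is one.  Such a stage is recognized by Buchberger's           *)
(* criterion, and membership is then tested by reduction to normal form.       *)
(* Coefficients and variables are only ever computed from those of the input:  *)
(* the sets of their codes need not be recursively enumerable, so an unbounded *)
(* search for a certificate of membership would not be effective.              *)
Require Import Defs.
From mathcomp Require Import all_boot all_order all_algebra.
From mathcomp Require Import finmap monalg boolp wochoice ring zify.

Set Implicit Arguments.
Unset Strict Implicit.
Unset Printing Implicit Defensive.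

Import GRing.Theory.

(** * Recursive functions on natural numbers *)

(** Embeddings preserve and reflect the definable well order [R], and none of them moves a variable
    down ([embedding_increasing]). Compare monomials at the largest variable where their exponents
    differ. Multiplication and renaming are then strictly monotone ([word_lt_act]), and a multiple
    of a renamed monomial is never smaller than the monomial itself ([word_le_act]). Read on
    exponents, omega-well structuredness is Dickson's lemma up to embedding ([finite_basis]); with
    [word_le_act] it also makes the monomial order well founded ([word_lt_wf]).

    Leading monomials thus commute with taking multiples, and Buchberger's argument applies. If
    every cancelling pair of multiples of generators can be rewritten with strictly smaller leading
    monomials, then the leading monomial of each nonzero element of the ideal is a multiple of a
    renamed leading monomial of a generator ([spairs_reduce_reducible]). Two generators have
    infinitely many pairs of renamings, but (C2) factors all of them through finitely many
    ([spairs_reduce_amalgams]), so each pair of generators has finitely many S-polynomials.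

    Reduction needs a twist. If a generator [g] divides the leading monomial of [h] after some
    renaming, (C2) only yields a listed pair [(r, r')] such that [g] renamed by [r'] divides the
    leading monomial of [h] renamed by [r], where some embedding inverts [r] on the variables of
    [h]. So the image of [h] is reduced, and (C1) certifies that [r] can be undone. The leading
    monomial still decreases ([reducts_lead_lt]), and a representation of the result can be carried
    back to [h] ([reducts_span]).

    Completion reaches a Groebner basis at a finite stage ([basis_complete_exists]), and membership
    then means that the normal form is zero ([ideal_normal_form]). The stage and the number of
    reduction steps are found by minimization ([computable_minimum]). The order [R] is itself
    decidable, since (C1) compares a pair with finitely many model pairs ([strict_order_basis],
    [computable_order]). *)

Definition nat_computable k (f : seq nat -> nat) : Prop :=
  exists c, forall v, size v = k -> computes c v (f v).

Lemma eq_nat_computable k f g :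
  (forall v, size v = k -> f v = g v) ->
  nat_computable k f -> nat_computable k g.
Proof. by move=> fg [c cP]; exists c => v sv; rewrite -fg //; apply: cP. Qed.

Lemma computes_projs i k v :
  i + k <= size v -> computes_all (map Proj (iota i k)) v (take k (drop i v)).
Proof.
elim: k i => [|k IHk] i le_ik; first by rewrite take0; constructor.
have lt_i : i < size v by rewrite (leq_trans _ le_ik) // -addSnnS leq_addr.
rewrite /= (drop_nth 0 lt_i) /=; constructor; first exact: computes_proj.
by apply: IHk; rewrite addSnnS.
Qed.

Section NatComputable.

Variable k : nat.
Implicit Types f g : seq nat -> nat.

Lemma nat_computable_proj i : i < k -> nat_computable k (nth 0 ^~ i).
Proof.
by move=> lt_ik; exists (Proj i) => v sv; apply: computes_proj; rewrite sv.
Qed.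

Lemma nat_computable_drop i f :
  nat_computable k f -> nat_computable (i + k) (fun v => f (drop i v)).
Proof.
case=> c cP; exists (Comp c (map Proj (iota i k))) => v sv.
have sd : size (drop i v) = k by rewrite size_drop sv addKn.
apply: computes_comp (cP _ sd).
by have := @computes_projs i k v; rewrite take_oversize ?sd //; apply; rewrite sv.
Qed.

Lemma nat_computable_succ f :
  nat_computable k f -> nat_computable k (fun v => (f v).+1).
Proof.
case=> c cP; exists (Comp Succ [:: c]) => v sv.
by econstructor; [do 2?econstructor; exact: cP|constructor].
Qed.

Lemma nat_computable_const n : nat_computable k (fun=> n).
Proof.
elim: n => [|n IHn]; last exact: nat_computable_succ.
by exists Zero => v _; constructor.
Qed.

Lemma nat_computable_rec n z s :
  nat_computable k n -> nat_computable k z -> nat_computable k.+2 s ->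
  nat_computable k
    (fun v => nat_rec (fun=> nat) (z v) (fun m y => s [:: m, y & v]) (n v)).
Proof.
case=> cn cnP [cz czP] [cs csP].
exists (Comp (PrimRec cz cs) (cn :: map Proj (iota 0 k))) => v sv.
apply: (@computes_comp _ _ _ (n v :: v)).
  constructor; first exact: cnP.
  by have := @computes_projs 0 k v; rewrite drop0 -sv take_size; apply.
elim: (n v) => [|m IHm] /=; first by constructor; apply: czP.
by apply: computes_recS IHm _; apply: csP; rewrite /= sv.
Qed.

Lemma nat_computable_mu f g :
  nat_computable k.+1 f ->
  (forall v, size v = k -> f (g v :: v) = 0 /\
     forall m, m < g v -> 0 < f (m :: v)) ->
  nat_computable k g.
Proof.
case=> c cP fg; exists (Mu c) => v sv; have [f0 f1] := fg v sv.
(* The rule for [Mu] wants each earlier value written as a successor, hence the predecessor. *)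
apply: (@computes_mu c v (g v) (fun m => (f (m :: v)).-1)) => [m lt_m|].
  by rewrite prednK ?f1 //; apply: cP; rewrite /= sv.
by rewrite -f0; apply: cP; rewrite /= sv.
Qed.

End NatComputable.

Section Arithmetic.

Variable k : nat.
Implicit Types f g : seq nat -> nat.

Lemma nat_computable_add f g :
  nat_computable k f -> nat_computable k g -> nat_computable k (fun v => f v + g v).
Proof.
move=> fP gP; have := nat_computable_rec fP gP
  (nat_computable_succ (@nat_computable_proj k.+2 1 isT)).
by apply: eq_nat_computable => v _; elim: (f v) => //= n ->.
Qed.

Lemma nat_computable_mul f g :
  nat_computable k f -> nat_computable k g -> nat_computable k (fun v => f v * g v).
Proof.
move=> fP gP.
suff sP : nat_computable k.+2 (fun v => g (drop 2 v) + nth 0 v 1).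
  have := nat_computable_rec fP (nat_computable_const k 0) sP.
  apply: eq_nat_computable => v _; elim: (f v) => //= n ->.
  by rewrite drop0 mulSn.
have := nat_computable_drop 2 gP; case=> c cP.
have [d dP] : nat_computable 2 (fun v => nth 0 v 0 + nth 0 v 1).
  have := @nat_computable_rec 2 (nth 0 ^~ 0) (nth 0 ^~ 1) (fun v => (nth 0 v 1).+1).
  case=> [||| c' c'P]; try exact: nat_computable_proj.
    exact/nat_computable_succ/nat_computable_proj.
  exists c' => v sv; have := c'P v sv.
  by congr computes; elim: (nth 0 v 0) => //= n ->.
exists (Comp d [:: c; Proj 1]) => v sv.
apply: computes_comp (dP [:: _; _] _) => //.
constructor; first exact: cP; constructor; last by constructor.
by apply: computes_proj; rewrite sv.
Qed.

Lemma nat_computable_pred f :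
  nat_computable k f -> nat_computable k (fun v => (f v).-1).
Proof.
move=> fP; have := nat_computable_rec fP (nat_computable_const k 0)
  (@nat_computable_proj k.+2 0 isT).
by apply: eq_nat_computable => v _; case: (f v).
Qed.

Lemma nat_computable_eq0 f :
  nat_computable k f -> nat_computable k (fun v => f v == 0).
Proof.
move=> fP; have := nat_computable_rec fP (nat_computable_const k 1)
  (nat_computable_const k.+2 0).
by apply: eq_nat_computable => v _; case: (f v).
Qed.

End Arithmetic.

Section Comparison.

Variable k : nat.
Implicit Types f g : seq nat -> nat.

Lemma nat_computable_sub f g :
  nat_computable k f -> nat_computable k g -> nat_computable k (fun v => f v - g v).
Proof.
move=> fP gP; have := nat_computable_rec gP fP
  (nat_computable_pred (@nat_computable_proj k.+2 1 isT)).
apply: eq_nat_computable => v _; elim: (g v) => [|n /= ->]; first by rewrite subn0.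
by rewrite subnS.
Qed.

Lemma nat_computable_leq f g :
  nat_computable k f -> nat_computable k g -> nat_computable k (fun v => f v <= g v).
Proof. by move=> fP gP; apply/nat_computable_eq0/nat_computable_sub. Qed.

Lemma nat_computable_eq f g :
  nat_computable k f -> nat_computable k g -> nat_computable k (fun v => f v == g v).
Proof.
move=> fP gP; have := nat_computable_mul (nat_computable_leq fP gP) (nat_computable_leq gP fP).
by apply: eq_nat_computable => v _; rewrite eqn_leq mulnb.
Qed.

Lemma nat_computable_exp2 f :
  nat_computable k f -> nat_computable k (fun v => 2 ^ f v).
Proof.
move=> fP; have := nat_computable_rec fP (nat_computable_const k 1)
  (nat_computable_add (@nat_computable_proj k.+2 1 isT) (@nat_computable_proj k.+2 1 isT)).
by apply: eq_nat_computable => v _; elim: (f v) => //= n ->; rewrite addnn expnS mul2n.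
Qed.

End Comparison.

Lemma nat_computable_div k f g :
  nat_computable k f -> nat_computable k g -> nat_computable k (fun v => f v %/ g v).
Proof.
move=> fP gP; have [f1P g1P] := (nat_computable_drop 1 fP, nat_computable_drop 1 gP).
(* The quotient is the least [q] for which [q + 1] times the divisor exceeds the dividend. The last
   factor stops the search at 0 when the divisor is 0, as the convention for division by 0
   requires. *)
pose t w := ((nth 0 w 0).+1 * g (drop 1 w) <= f (drop 1 w)) * (1 <= g (drop 1 w)).
apply: (@nat_computable_mu _ t).
  have xP : nat_computable (1 + k) (fun w => (nth 0 w 0).+1).
    exact/nat_computable_succ/nat_computable_proj.
  by apply: eq_nat_computable (nat_computable_mul
    (nat_computable_leq (nat_computable_mul xP g1P) f1P)
    (nat_computable_leq (nat_computable_const _ 1) g1P)).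
move=> v _; rewrite /t /= drop0; case: (posnP (g v)) => [->|g_gt0].
  by rewrite divn0 muln0; split.
rewrite muln1 -leq_divRL // ltnn; split=> // m lt_m.
by rewrite -leq_divRL // lt_m.
Qed.

Lemma nat_computable_logn2 k f :
  nat_computable k f -> nat_computable k (fun v => logn 2 (f v)).
Proof.
move=> fP; have f1P := nat_computable_drop 1 fP.
(* The valuation is the least [e] such that [2 ^ (e + 1)] does not divide; the last factor makes the
   valuation of 0 equal to 0. *)
pose t w := (2 ^ (nth 0 w 0).+1 * (f (drop 1 w) %/ 2 ^ (nth 0 w 0).+1) == f (drop 1 w)) *
            (1 <= f (drop 1 w)).
have eP : nat_computable (1 + k) (fun w => 2 ^ (nth 0 w 0).+1).
  exact/nat_computable_exp2/nat_computable_succ/nat_computable_proj.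
apply: (@nat_computable_mu _ t).
  by apply: eq_nat_computable (nat_computable_mul
    (nat_computable_eq (nat_computable_mul eP (nat_computable_div f1P eP)) f1P)
    (nat_computable_leq (nat_computable_const _ 1) f1P)).
move=> v _; rewrite /t /= drop0; case: (posnP (f v)) => [->|f_gt0].
  by rewrite logn0 muln0; split.
by split=> [|m lt_m]; rewrite muln1 mulnC -dvdn_eq pfactor_dvdn // ?ltnn // lt_m.
Qed.

(** * Computable functions on countable types *)

(** The code of [n :: s] is [2 ^ n] times the odd number [2 * code s + 1], so the valuation at 2
    recovers [n]. *)
Definition code_head c := logn 2 c.
Definition code_tail c := c %/ 2 ^ logn 2 c %/ 2.

Lemma code_cons_headK n s : code_head (CodeSeq.code (n :: s)) = n.
Proof.
by rewrite /code_head /= lognM ?expn_gt0 // pfactorK // lognE dvdn2 /= odd_double /= addn0.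
Qed.

Lemma code_cons_tailK n s : code_tail (CodeSeq.code (n :: s)) = CodeSeq.code s.
Proof.
rewrite /code_tail -/(code_head _) code_cons_headK /= mulKn ?expn_gt0 //.
by rewrite divn2 /= uphalf_double.
Qed.

Section NatCode.

Variable k : nat.
Implicit Types f g : seq nat -> nat.

Lemma nat_computable_code_cons f g :
  nat_computable k f -> nat_computable k g ->
  nat_computable k (fun v => 2 ^ f v * (g v).*2.+1).
Proof.
move=> fP gP; apply: (@eq_nat_computable _ (fun v => 2 ^ f v * (g v + g v).+1)).
  by move=> v _; rewrite addnn.
by apply: nat_computable_mul; [exact: nat_computable_exp2|
  exact/nat_computable_succ/nat_computable_add].
Qed.

Lemma nat_computable_code_head f :
  nat_computable k f -> nat_computable k (fun v => code_head (f v)).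
Proof. exact: nat_computable_logn2. Qed.

Lemma nat_computable_code_tail f :
  nat_computable k f -> nat_computable k (fun v => code_tail (f v)).
Proof.
move=> fP; apply: nat_computable_div (nat_computable_const _ 2).
exact/(nat_computable_div fP)/nat_computable_exp2/nat_computable_logn2.
Qed.

End NatCode.

Lemma eq_computable (X Y : countType) (f g : X -> Y) :
  f =1 g -> computable f -> computable g.
Proof. by move=> fg [c cP]; exists c => x Dx; rewrite -fg; apply: cP. Qed.

Lemma computable_code (X Y : countType) (f : X -> Y) h :
  nat_computable 1 h -> (forall x, choice.pickle (f x) = h [:: choice.pickle x]) -> computable f.
Proof. by case=> c cP fh; exists c => x _; rewrite fh; apply: cP. Qed.

Lemma computable_code1 (X Y Z : countType) (f : X -> Y) (g : X -> Z) h :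
  nat_computable 1 h -> (forall x, choice.pickle (g x) = h [:: choice.pickle (f x)]) ->
  computable f -> computable g.
Proof.
case=> c cP fh [d dP]; exists (Comp c [:: d]) => x _; rewrite fh.
by apply: computes_comp (cP _ _) => //; do 2?constructor; apply: dP.
Qed.

Lemma computable_code2 (X Y Y' Z : countType) (f : X -> Y) (f' : X -> Y') (g : X -> Z) h :
  nat_computable 2 h ->
  (forall x, choice.pickle (g x) = h [:: choice.pickle (f x); choice.pickle (f' x)]) ->
  computable f -> computable f' -> computable g.
Proof.
case=> c cP fh [d dP] [d' d'P]; exists (Comp c [:: d; d']) => x _; rewrite fh.
apply: computes_comp (cP _ _) => //.
by constructor; [apply: dP|do 2?constructor; apply: d'P].
Qed.

Lemma computable_id (X : countType) : computable (fun x : X => x).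
Proof. exact: (@computable_code _ _ _ (nth 0 ^~ 0)) (@nat_computable_proj 1 0 isT) _. Qed.

Lemma computable_cst (X Y : countType) (y : Y) : computable (fun _ : X => y).
Proof. exact: (@computable_code _ _ _ (fun=> choice.pickle y)) (nat_computable_const 1 _) _. Qed.

Lemma computable_comp (X Y Z : countType) (g : Y -> Z) (f : X -> Y) :
  computable g -> computable f -> computable (fun x => g (f x)).
Proof.
case=> c cP [d dP]; exists (Comp c [:: d]) => x _.
by apply: computes_comp (cP _ _) => //; do 2?constructor; apply: dP.
Qed.

Lemma computable_on_comp (X Y Z : countType) (D : Y -> Prop) (g : Y -> Z) (f : X -> Y) :
  computable_on D g -> computable f -> computable_on (fun x => D (f x)) (fun x => g (f x)).
Proof.
case=> c cP [d dP]; exists (Comp c [:: d]) => x Dx.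
by apply: computes_comp (cP _ _) => //; do 2?constructor; apply: dP.
Qed.

Lemma computable_on_total (X Y : countType) (D : X -> Prop) (f : X -> Y) :
  (forall x, D x) -> computable_on D f -> computable f.
Proof. by move=> Dx [c cP]; exists c => x _; apply: cP. Qed.

Lemma pickle_pair (T U : countType) (x : T * U) :
  choice.pickle x = CodeSeq.code [:: choice.pickle x.1; choice.pickle x.2].
Proof. by case: x. Qed.

Section Pairs.

Variables X Y Z : countType.

Lemma computable_pair (f : X -> Y) (g : X -> Z) :
  computable f -> computable g -> computable (fun x => (f x, g x)).
Proof.
apply: (@computable_code2 _ _ _ _ _ _ _
  (fun v => CodeSeq.code [:: nth 0 v 0; nth 0 v 1])); last exact: (fun=> pickle_pair _).
apply: (@nat_computable_code_cons 2 (nth 0 ^~ 0)); first exact: nat_computable_proj.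
apply: (@nat_computable_code_cons 2 (nth 0 ^~ 1)); first exact: nat_computable_proj.
exact: nat_computable_const.
Qed.

Lemma computable_fst (f : X -> Y * Z) : computable f -> computable (fun x => (f x).1).
Proof.
apply: (@computable_code1 _ _ _ _ _ (fun v => code_head (nth 0 v 0))).
  exact/nat_computable_code_head/nat_computable_proj.
by move=> x; rewrite [nth _ _ _]pickle_pair code_cons_headK.
Qed.

Lemma computable_snd (f : X -> Y * Z) : computable f -> computable (fun x => (f x).2).
Proof.
apply: (@computable_code1 _ _ _ _ _ (fun v => code_head (code_tail (nth 0 v 0)))).
  exact/nat_computable_code_head/nat_computable_code_tail/nat_computable_proj.
by move=> x; rewrite [nth _ _ _]pickle_pair code_cons_tailK code_cons_headK.
Qed.

End Pairs.

(** The boolean serves as recursion counter: at 0 only [g] runs, at 1 [f] runs too. Hence [f] may be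
    computable only under the promise [b], which is how a promise problem such as (C1) becomes a
    total test. *)
Lemma computable_on_if (X Y : countType) (b : X -> bool) (f g : X -> Y) :
  computable b -> computable_on (fun x => b x) f -> computable g ->
  computable (fun x => if b x then f x else g x).
Proof.
case=> cb cbP [cf cfP] [cg cgP].
exists (Comp (PrimRec cg (Comp cf [:: Proj 2])) [:: cb; Proj 0]) => x _.
apply: (@computes_comp _ _ _ [:: nat_of_bool (b x); choice.pickle x]).
  constructor; first exact: cbP.
  by constructor; last constructor; exact: (@computes_proj 0 [:: choice.pickle x]).
have c0 : computes (PrimRec cg (Comp cf [:: Proj 2])) [:: 0; choice.pickle x] (choice.pickle (g x)).
  by constructor; apply: cgP.
case bx: (b x) => //=; apply: computes_recS c0 _.
apply: (@computes_comp _ _ _ [:: choice.pickle x]); last exact: cfP.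
by constructor; last constructor; exact: (@computes_proj 2 [:: _; _; choice.pickle x]).
Qed.

Lemma computable_if (X Y : countType) (b : X -> bool) (f g : X -> Y) :
  computable b -> computable f -> computable g ->
  computable (fun x => if b x then f x else g x).
Proof.
move=> bP fP; apply: computable_on_if => //.
by case: fP => c cP; exists c => x _; apply: cP.
Qed.

Section Logic.

Variables (X Y : countType).

Lemma computable_negb (b : X -> bool) : computable b -> computable (fun x => ~~ b x).
Proof. by move=> bP; apply: computable_if bP _ _; apply: computable_cst. Qed.

Lemma computable_andb (b b' : X -> bool) :
  computable b -> computable b' -> computable (fun x => b x && b' x).
Proof. by move=> bP b'P; apply: computable_if bP b'P _; apply: computable_cst. Qed.

Lemma computable_orb (b b' : X -> bool) :
  computable b -> computable b' -> computable (fun x => b x || b' x).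
Proof. by move=> bP; apply: computable_if bP _; apply: computable_cst. Qed.

Lemma computable_implyb (b b' : X -> bool) :
  computable b -> computable b' -> computable (fun x => b x ==> b' x).
Proof. by move=> bP b'P; apply: computable_if bP b'P _; apply: computable_cst. Qed.

Lemma computable_eqn (f g : X -> nat) :
  computable f -> computable g -> computable (fun x => f x == g x).
Proof.
apply: (@computable_code2 _ _ _ _ _ _ _ (fun v => nth 0 v 0 == nth 0 v 1)) => //.
by apply: nat_computable_eq; apply: nat_computable_proj.
Qed.

Lemma computable_pickle (f : X -> Y) : computable f -> computable (fun x => choice.pickle (f x)).
Proof. by case=> c cP; exists c. Qed.

End Logic.

Lemma computable_eq (X Y : countType) (f g : X -> Y) :
  computable f -> computable g -> computable (fun x => f x == g x).
Proof.
move=> fP gP; have := computable_eqn (computable_pickle fP) (computable_pickle gP).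
by apply: eq_computable => x; rewrite (inj_eq (pcan_inj choice.pickleK)).
Qed.

Section Naturals.

Variable X : countType.
Implicit Types f g : X -> nat.

Lemma computable_succ f : computable f -> computable (fun x => (f x).+1).
Proof.
apply: (@computable_code1 _ _ _ _ _ (fun v => (nth 0 v 0).+1)) => //.
exact/nat_computable_succ/nat_computable_proj.
Qed.

Lemma computable_subn f g : computable f -> computable g -> computable (fun x => f x - g x).
Proof.
apply: (@computable_code2 _ _ _ _ _ _ _ (fun v => nth 0 v 0 - nth 0 v 1)) => //.
by apply: nat_computable_sub; apply: nat_computable_proj.
Qed.

Lemma computable_leq f g : computable f -> computable g -> computable (fun x => f x <= g x).
Proof.
apply: (@computable_code2 _ _ _ _ _ _ _ (fun v => nth 0 v 0 <= nth 0 v 1)) => //.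
by apply: nat_computable_leq; apply: nat_computable_proj.
Qed.

(** Unbounded search, total because a witness exists for every input. The number of reduction steps
    and the stage of the completion are both obtained this way. *)
Lemma computable_minimum (P : X -> nat -> bool) f :
  computable (fun p : X * nat => P p.1 p.2) ->
  (forall x, P x (f x) /\ forall m, P x m -> f x <= m) -> computable f.
Proof.
case=> c cP fP; have [d dP] := @nat_computable_eq0 1 _ (@nat_computable_proj 1 0 isT).
(* [Mu] puts the candidate before the input whereas the test takes it after, so [e] swaps the two;
   [d] turns truth into the value 0 that ends the search. *)
have [e eP] := computable_pair (computable_snd (computable_id (nat * X)%type))
  (computable_fst (computable_id (nat * X)%type)).
have [pr prP] : nat_computable 2 (fun v => CodeSeq.code [:: nth 0 v 0; nth 0 v 1]).
  apply: (@nat_computable_code_cons 2 (nth 0 ^~ 0)); first exact: nat_computable_proj.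
  apply: (@nat_computable_code_cons 2 (nth 0 ^~ 1)); first exact: nat_computable_proj.
  exact: nat_computable_const.
exists (Mu (Comp d [:: Comp c [:: Comp e [:: pr]]])) => x _.
have test m : computes (Comp d [:: Comp c [:: Comp e [:: pr]]]) [:: m; choice.pickle x] (~~ P x m).
  have -> : nat_of_bool (~~ P x m) = (nat_of_bool (P x m) == 0) by case: (P x m).
  apply: (@computes_comp _ _ _ [:: nat_of_bool (P x m)]); last exact: (dP [:: _]).
  constructor; last constructor.
  apply: (@computes_comp _ _ _ [:: choice.pickle (x, m)]); last exact: (cP (x, m)).
  constructor; last constructor.
  apply: (@computes_comp _ _ _ [:: choice.pickle (m, x)]); last exact: (eP (m, x)).
  by constructor; last constructor; rewrite pickle_pair; apply: (prP [:: m; choice.pickle x]).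
have [Pf minf] := fP x.
apply: (@computes_mu _ _ _ (fun=> 0)) => [m lt_m|]; last by have := test (f x); rewrite Pf.
have := test m; case Pm: (P x m) => //.
by have := minf m Pm; rewrite leqNgt lt_m.
Qed.

End Naturals.

Lemma computable_iter (X Y : countType) (n : X -> nat) (s : X -> Y -> Y) (z : X -> Y) :
  computable n -> computable z -> computable (fun p : X * Y => s p.1 p.2) ->
  computable (fun x => iter (n x) (s x) (z x)).
Proof.
case=> cn cnP [cz czP] [cs csP].
have [pr prP] : nat_computable 3 (fun v => CodeSeq.code [:: nth 0 v 2; nth 0 v 1]).
  apply: (@nat_computable_code_cons 3 (nth 0 ^~ 2)); first exact: nat_computable_proj.
  apply: (@nat_computable_code_cons 3 (nth 0 ^~ 1)); first exact: nat_computable_proj.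
  exact: nat_computable_const.
exists (Comp (PrimRec cz (Comp cs [:: pr])) [:: cn; Proj 0]) => x _.
apply: (@computes_comp _ _ _ [:: n x; choice.pickle x]).
  constructor; first exact: cnP.
  by constructor; last constructor; exact: (@computes_proj 0 [:: choice.pickle x]).
elim: (n x) => [|m IHm] /=; first by constructor; apply: czP.
apply: computes_recS IHm _; set y := iter _ _ _.
apply: (@computes_comp _ _ _ [:: choice.pickle (x, y)]); last exact: (csP (x, y)).
by constructor; last constructor; rewrite pickle_pair; apply: (prP [:: _; _; _]).
Qed.

Section Lists.

Variables X Y : countType.
Implicit Types l s : X -> seq Y.

Lemma computable_cons f l :
  computable f -> computable l -> computable (fun x => f x :: l x : seq Y).
Proof.
apply: (@computable_code2 _ _ _ _ _ _ _ (fun v => 2 ^ nth 0 v 0 * (nth 0 v 1).*2.+1)) => //.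
by apply: nat_computable_code_cons; apply: nat_computable_proj.
Qed.

(** No default element of [Y] is available, so the branch [f] is run only under the promise that the
    list is nonempty; head and tail are read off its code. *)
Lemma computable_case (Z : countType) (f : X -> Y -> seq Y -> Z) g l :
  computable l -> computable g ->
  computable (fun p : X * (Y * seq Y) => f p.1 p.2.1 p.2.2) ->
  computable (fun x => if l x is y :: r then f x y r else g x).
Proof.
move=> lP gP [cf cfP]; set h := (X in computable X).
apply: (@eq_computable _ _ (fun x => if l x != [::] then h x else g x)).
  by move=> x; rewrite /h; case: (l x).
apply: computable_on_if gP.
  by apply/computable_negb/computable_eq => //; apply: computable_cst.
have [c cP] : nat_computable 2 (fun v => CodeSeq.code
    [:: nth 0 v 0; CodeSeq.code [:: code_head (nth 0 v 1); code_tail (nth 0 v 1)]]).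
  have P0 := @nat_computable_proj 2 0 isT; have P1 := @nat_computable_proj 2 1 isT.
  apply: (nat_computable_code_cons P0).
  apply: (@nat_computable_code_cons 2 (fun v =>
    CodeSeq.code [:: code_head (nth 0 v 1); code_tail (nth 0 v 1)]))
    (nat_computable_const 2 0).
  apply: (nat_computable_code_cons (nat_computable_code_head P1)).
  apply: (nat_computable_code_cons (nat_computable_code_tail P1)).
  exact: nat_computable_const.
case: lP => cl clP; exists (Comp cf [:: Comp c [:: Proj 0; cl]]) => x.
rewrite /h; case lx: (l x) => [//|y r] _.
apply: (@computes_comp _ _ _ [:: choice.pickle (x, (y, r))]); last exact: (cfP (x, (y, r))).
constructor; last constructor.
apply: (@computes_comp _ _ _ [:: choice.pickle x; choice.pickle (l x)]).
  constructor; first exact: (@computes_proj 0 [:: choice.pickle x]).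
  by constructor; last constructor; apply: clP.
have -> : choice.pickle (x, (y, r)) = CodeSeq.code
    [:: choice.pickle x; CodeSeq.code [:: code_head (choice.pickle (l x)); code_tail (choice.pickle (l x))]].
  rewrite lx [choice.pickle (y :: r)]/(CodeSeq.code (choice.pickle y :: map choice.pickle r)).
  by rewrite code_cons_headK code_cons_tailK !pickle_pair.
exact: (cP [:: choice.pickle x; choice.pickle (l x)]).
Qed.

End Lists.

(** An iteration needs a number of rounds known in advance; the code of the list is a computable
    bound for a traversal. *)
Lemma size_le_pickle (Y : countType) (s : seq Y) : size s <= choice.pickle s.
Proof.
rewrite -[choice.pickle s]/(CodeSeq.code (map choice.pickle s)).
elim: s => //= y s IHs; apply: (@leq_trans (CodeSeq.code (map choice.pickle s)).*2.+1).
  by rewrite ltnS (leq_trans IHs) // -addnn leq_addr.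
by rewrite leq_pmull // expn_gt0.
Qed.

Lemma computable_foldl (X Y Z : countType) (f : X -> Z -> Y -> Z) (z : X -> Z) (l : X -> seq Y) :
  computable z -> computable l -> computable (fun p : X * Z * Y => f p.1.1 p.1.2 p.2) ->
  computable (fun x => foldl (f x) (z x) (l x)).
Proof.
move=> zP lP fP.
(* On the empty list the step does nothing, so iterating too often is harmless. *)
pose step x (a : seq Y * Z) := if a.1 is y :: r then (r, f x a.2 y) else a.
have stepE x n a r : size r <= n -> (iter n (step x) (r, a)).2 = foldl (f x) a r.
  by elim: n a r => [|n IHn] a [|y r] // sr; rewrite iterSr; apply: IHn.
apply: (@eq_computable _ _ (fun x => (iter (choice.pickle (l x)) (step x) (l x, z x)).2)).
  by move=> x; apply: stepE; apply: size_le_pickle.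
apply/computable_snd/computable_iter; [exact: computable_pickle|exact: computable_pair|].
have idP := computable_id (X * (seq Y * Z))%type.
apply: (@computable_case _ _ _ (fun p y r => (r, f p.1 p.2.2 y))).
- exact/computable_fst/computable_snd.
- exact/computable_snd.
have jP := computable_id (X * (seq Y * Z) * (Y * seq Y))%type.
apply: computable_pair; first exact/computable_snd/computable_snd.
apply: (@computable_comp _ _ _ _ (fun p => (p.1.1, p.1.2.2, p.2.1)) fP).
apply: computable_pair; first apply: computable_pair.
- exact/computable_fst/computable_fst.
- exact/computable_snd/computable_snd/computable_fst.
- exact/computable_fst/computable_snd.
Qed.

Lemma computable_comp2 (X Y Y' Z : countType) (g : Y -> Y' -> Z) (f : X -> Y) (f' : X -> Y') :
  computable (fun p : Y * Y' => g p.1 p.2) -> computable f -> computable f' ->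
  computable (fun x => g (f x) (f' x)).
Proof.
move=> gP fP f'P.
exact: (@computable_comp _ _ _ _ (fun x => (f x, f' x)) gP (computable_pair fP f'P)).
Qed.

Lemma computable_foldr (X Y Z : countType) (f : X -> Y -> Z -> Z) (z : X -> Z) (l : X -> seq Y) :
  computable z -> computable l -> computable (fun p : X * Y * Z => f p.1.1 p.1.2 p.2) ->
  computable (fun x => foldr (f x) (z x) (l x)).
Proof.
move=> zP lP fP.
have idP := computable_id (X * Z * Y)%type; have idP' := computable_id (X * seq Y * Y)%type.
apply: (@eq_computable _ _ (fun x => foldl (fun a y => f x y a) (z x) (rev (l x)))).
  by move=> x; rewrite foldl_rev.
apply: (@computable_foldl _ _ _ (fun x a y => f x y a)) => //; last first.
  apply: (@computable_comp _ _ _ _ (fun p => (p.1.1, p.2, p.1.2)) fP).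
  apply: computable_pair; first apply: computable_pair.
  - exact/computable_fst/computable_fst.
  - exact: computable_snd.
  - exact/computable_snd/computable_fst.
apply: (@eq_computable _ _ (fun x => foldl (fun a y => y :: a) [::] (l x))).
  move=> x; rewrite -[RHS]cats0 -catrevE; by elim: (l x) [::] => //=.
apply: (@computable_foldl _ _ _ (fun _ a y => y :: a)) => //; first exact: computable_cst.
by apply: computable_cons; [exact: computable_snd|exact/computable_snd/computable_fst].
Qed.

Ltac computable_proj :=
  repeat first [ exact: computable_id | apply: computable_fst | apply: computable_snd ].

Section Lists.

Variables X Y : countType.
Implicit Types l : X -> seq Y.

Lemma computable_cat s l :
  computable s -> computable l -> computable (fun x => s x ++ l x).
Proof.
move=> sP lP; apply: (@eq_computable _ _ (fun x => foldr cons (l x) (s x))).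
  by move=> x; elim: (s x) => //= y r ->.
apply: (@computable_foldr _ _ _ (fun _ => cons)) => //.
by apply: computable_cons; computable_proj.
Qed.

Lemma computable_map (Z : countType) (f : X -> Y -> Z) l :
  computable (fun p : X * Y => f p.1 p.2) -> computable l ->
  computable (fun x => map (f x) (l x)).
Proof.
move=> fP lP; apply: (@eq_computable _ _ (fun x => foldr (fun y s => f x y :: s) [::] (l x))).
  by move=> x; elim: (l x) => //= y s ->.
apply: (@computable_foldr _ _ _ (fun x y s => f x y :: s)) => //; first exact: computable_cst.
by apply: computable_cons; [apply: (computable_comp2 fP)|]; computable_proj.
Qed.

Lemma computable_filter (b : X -> Y -> bool) l :
  computable (fun p : X * Y => b p.1 p.2) -> computable l ->
  computable (fun x => filter (b x) (l x)).
Proof.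
move=> bP lP.
apply: (@eq_computable _ _ (fun x => foldr (fun y s => if b x y then y :: s else s) [::] (l x))).
  by move=> x; elim: (l x) => //= y s ->.
apply: (@computable_foldr _ _ _ (fun x y s => if b x y then y :: s else s)) => //.
  exact: computable_cst.
apply: computable_if; first by apply: (computable_comp2 bP); computable_proj.
  by apply: computable_cons; computable_proj.
by computable_proj.
Qed.

Lemma computable_all (b : X -> Y -> bool) l :
  computable (fun p : X * Y => b p.1 p.2) -> computable l ->
  computable (fun x => all (b x) (l x)).
Proof.
move=> bP lP; apply: (@eq_computable _ _ (fun x => foldr (fun y c => b x y && c) true (l x))).
  by move=> x; elim: (l x) => //= y s ->.
apply: (@computable_foldr _ _ _ (fun x y c => b x y && c)) => //; first exact: computable_cst.
by apply: computable_andb; [apply: (computable_comp2 bP)|]; computable_proj.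
Qed.

Lemma computable_has (b : X -> Y -> bool) l :
  computable (fun p : X * Y => b p.1 p.2) -> computable l ->
  computable (fun x => has (b x) (l x)).
Proof.
move=> bP lP; apply: (@eq_computable _ _ (fun x => foldr (fun y c => b x y || c) false (l x))).
  by move=> x; elim: (l x) => //= y s ->.
apply: (@computable_foldr _ _ _ (fun x y c => b x y || c)) => //; first exact: computable_cst.
by apply: computable_orb; [apply: (computable_comp2 bP)|]; computable_proj.
Qed.

Lemma computable_size l : computable l -> computable (fun x => size (l x)).
Proof.
move=> lP; apply: (@eq_computable _ _ (fun x => foldr (fun y c => c.+1) 0 (l x))).
  by move=> x; elim: (l x) => //= y s ->.
apply: (@computable_foldr _ _ _ (fun x y c => c.+1)) => //; first exact: computable_cst.
by apply: computable_succ; computable_proj.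
Qed.

Lemma computable_nseq n (y : X -> Y) :
  computable n -> computable y -> computable (fun x => nseq (n x) (y x)).
Proof.
move=> nP yP; apply: (@eq_computable _ _ (fun x => iter (n x) (cons (y x)) [::])).
  by move=> x; rewrite /nseq /ncons.
apply: (@computable_iter _ _ _ (fun x => cons (y x))) => //; first exact: computable_cst.
by apply: computable_cons; [apply: (computable_comp yP)|]; computable_proj.
Qed.

Lemma computable_head (y : X -> Y) s :
  computable y -> computable s -> computable (fun x => head (y x) (s x)).
Proof.
move=> yP sP; apply: (@computable_case _ _ _ (fun _ z _ => z)) => //.
by computable_proj.
Qed.

Lemma computable_behead (s : X -> seq Y) : computable s -> computable (fun x => behead (s x)).
Proof.
move=> sP; apply: (@eq_computable _ _ (fun x => if s x is _ :: r then r else [::])) => //.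
apply: (@computable_case _ _ _ (fun _ _ r => r)) => //; first exact: computable_cst.
by computable_proj.
Qed.

End Lists.

Lemma computable_nth (X Y : countType) (y : X -> Y) (s : X -> seq Y) (n : X -> nat) :
  computable y -> computable s -> computable n -> computable (fun x => nth (y x) (s x) (n x)).
Proof.
move=> yP sP nP; apply: (@eq_computable _ _ (fun x => head (y x) (iter (n x) behead (s x)))).
  move=> x; rewrite -nth0; have -> m t : iter m behead t = drop m t :> seq Y.
    by elim: m t => [|m IHm] t; rewrite ?drop0 // iterSr IHm; case: t.
  by rewrite nth_drop addn0.
apply: computable_head => //.
apply: (@computable_iter _ _ _ (fun=> behead)) => //.
by apply: computable_behead; computable_proj.
Qed.

Lemma computable_flatten (X Y : countType) (l : X -> seq (seq Y)) :
  computable l -> computable (fun x => flatten (l x)).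
Proof.
move=> lP; apply: (@computable_foldr _ _ _ (fun _ => cat)) => //; first exact: computable_cst.
by apply: computable_cat; computable_proj.
Qed.

Section Search.

Variables (X Y : countType) (y : X -> Y) (l : X -> seq Y).
Hypotheses (yP : computable y) (lP : computable l).

Lemma computable_mem : computable (fun x => y x \in l x).
Proof.
apply: (@eq_computable _ _ (fun x => has (pred1 (y x)) (l x))).
  by move=> x; rewrite has_pred1.
apply: (@computable_has _ _ (fun x => pred1 (y x))) => //.
by apply: computable_eq; [|apply: (computable_comp yP)]; computable_proj.
Qed.

Lemma computable_count_mem : computable (fun x => count_mem (y x) (l x)).
Proof.
apply: (@eq_computable _ _ (fun x => size (filter (pred1 (y x)) (l x)))).
  by move=> x; rewrite size_filter.
apply/computable_size/(@computable_filter _ _ (fun x => pred1 (y x))) => //.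
by apply: computable_eq; [|apply: (computable_comp yP)]; computable_proj.
Qed.

Lemma computable_index : computable (fun x => index (y x) (l x)).
Proof.
apply: (@eq_computable _ _ (fun x => foldr (fun z n => if z == y x then 0 else n.+1) 0 (l x))).
  by move=> x; elim: (l x) => //= z s ->.
apply: (@computable_foldr _ _ _ (fun x z n => if z == y x then 0 else n.+1)) => //.
  exact: computable_cst.
apply: computable_if; last by apply: computable_succ; computable_proj.
  by apply: computable_eq; [|apply: (computable_comp yP)]; computable_proj.
exact: computable_cst.
Qed.

End Search.

Lemma computable_undup (X Y : countType) (l : X -> seq Y) :
  computable l -> computable (fun x => undup (l x)).
Proof.
move=> lP.
apply: (@eq_computable _ _ (fun x => foldr (fun z s => if z \in s then s else z :: s) [::] (l x))).
  by move=> x; elim: (l x) => //= z s ->; rewrite mem_undup.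
apply: (@computable_foldr _ _ _ (fun _ z (s : seq Y) => if z \in s then s else z :: s)) => //.
  exact: computable_cst.
apply: computable_if; first by apply: computable_mem; computable_proj.
  by computable_proj.
by apply: computable_cons; computable_proj.
Qed.

(** * Words of variables and their order *)

Lemma perm_count_memP (T : eqType) (s t : seq T) :
  reflect (forall x, count_mem x s = count_mem x t) (perm_eq s t).
Proof.
apply: (iffP idP) => [/permP st x|st]; first exact: st.
by apply/allP => x _; apply/eqP.
Qed.

Section Embeddings.

Variable A : rel_structure.
Implicit Types iota kappa : A -> A.

Lemma embedding_id : embedding (fun x : A => x).
Proof.
split=> // i t; suff -> : map_tuple (fun x : A => x) t = t by [].
by apply: val_inj; rewrite /= map_id.
Qed.

Lemma embedding_comp iota kappa :
  embedding iota -> embedding kappa -> embedding (fun x => iota (kappa x)).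
Proof.
move=> [ij ip] [kj kp]; split=> [x y /ij /kj //|i t].
rewrite -(kp i t) -(ip i (map_tuple kappa t)).
suff -> : map_tuple (fun x => iota (kappa x)) t = map_tuple iota (map_tuple kappa t) by [].
by apply: val_inj; rewrite /= -map_comp.
Qed.

Lemma qf_holds_embedding iota k (phi : qf_formula A k) (v : k.-tuple A) :
  embedding iota -> qf_holds phi (map_tuple iota v) <-> qf_holds phi v.
Proof.
move=> [ij ip]; elim: phi => [i t|x y|phi IH|phi IH psi IH'|phi IH psi IH'] /=; try tauto.
- rewrite -(ip i (map_tuple (tnth v) t)).
  suff -> : map_tuple (tnth (map_tuple iota v)) t = map_tuple iota (map_tuple (tnth v) t) by [].
  by apply: val_inj; rewrite /= -map_comp; apply: eq_map => x; rewrite /= tnth_map.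
- by rewrite !tnth_map; split=> [/ij|->].
Qed.

End Embeddings.

(* A word represents the monomial that is the product of its letters, so      *)
(* monomials are equal when their words are permutations of each other.       *)
Section Words.

Variable T : eqType.
Implicit Types (m : seq T) (R : rel T).

Lemma count_mem_flatten_nseq (F : T -> nat) r x : uniq r ->
  count_mem x (flatten [seq nseq (F y) y | y <- r]) = (x \in r) * F x.
Proof.
elim: r => //= y r IHr /andP[yr ur]; rewrite count_cat count_nseq IHr // inE /= eq_sym.
by case: eqP => [->|//]; rewrite (negPf yr) mul0n addn0.
Qed.

(** Since subtraction is truncated, this is the least common multiple of [m] and [m'] divided by
    [m']. *)
Definition word_diff m m' :=
  flatten [seq nseq (count_mem x m - count_mem x m') x | x <- undup m].

Lemma count_mem_word_diff x m m' :
  count_mem x (word_diff m m') = count_mem x m - count_mem x m'.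
Proof.
rewrite /word_diff (count_mem_flatten_nseq (fun x => count_mem x m - count_mem x m')) ?undup_uniq //.
by rewrite mem_undup; case: (boolP (x \in m)) => [_|/count_memPn->]; rewrite ?mul1n ?sub0n.
Qed.

(** The lexicographic order, decided at the largest letter where the multiplicities differ. Letters
    outside both words have multiplicity 0 in each, so the quantifiers can be bounded by the words,
    which makes the comparison computable. *)
Definition word_lt R m m' :=
  has (fun x => (count_mem x m < count_mem x m') &&
                all (fun y => R x y && (x != y) ==> (count_mem y m == count_mem y m')) (m ++ m')) m'.

Lemma word_ltP R m m' :
  reflect (exists2 x, count_mem x m < count_mem x m' &
             forall y, R x y -> x != y -> count_mem y m = count_mem y m') (word_lt R m m').
Proof.
apply: (iffP hasP) => [[x mx /andP[lt_x /allP eqx]]|[x lt_x eqx]]; exists x => //.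
- move=> y Rxy neq_xy; have [/eqx|] := boolP (y \in m ++ m').
    by rewrite Rxy neq_xy => /eqP.
  by rewrite mem_cat negb_or => /andP[/count_memPn-> /count_memPn->].
- by rewrite -has_pred1 has_count (leq_ltn_trans _ lt_x).
- rewrite lt_x; apply/allP => y _; apply/implyP => /andP[Rxy nxy].
  by apply/eqP/eqx.
Qed.

End Words.

(** * The lexicographic order on words and its behaviour under embeddings *)

Section WordOrder.

Variables (A : rel_structure) (R : rel A).
Hypotheses (woR : well_order R)
  (defR : definable (fun v : 2.-tuple A => R (tnth v ord0) (tnth v ord_max))).
Implicit Types (m w : seq A) (iota : A -> A).

Local Notation "m <w m'" := (word_lt R m m') (at level 70).

Lemma well_order_chain : wo_chain R predT.
Proof. by move=> C _; apply: woR. Qed.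

Lemma order_total x y : R x y || R y x.
Proof. exact: (wo_chainW well_order_chain). Qed.

Lemma order_refl x : R x x.
Proof. exact: (wo_chain_reflexive well_order_chain). Qed.

Lemma order_anti x y : R x y -> R y x -> x = y.
Proof. by move=> xy yx; apply: (wo_chain_antisymmetric well_order_chain) => //; rewrite xy. Qed.

Lemma order_minimum (P : A -> Prop) x : P x -> exists2 z, P z & forall y, P y -> R z y.
Proof.
move=> Px; case: (@woR (fun z => `[< P z >])); first by exists x; apply/asboolP.
by move=> z [[/asboolP Pz minz] _]; exists z => // y Py; apply/minz/asboolP.
Qed.

(** Consider which of [x], [y], [z] is least: if it is not [x], antisymmetry identifies two of the
    three. *)
Lemma order_trans y x z : R x y -> R y z -> R x z.
Proof.
move=> xy yz; have [|t] := @order_minimum (fun t => t \in [:: x; y; z]) x.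
  by rewrite !inE eqxx.
rewrite !inE => /or3P[/eqP->|/eqP->|/eqP->] mint.
- by apply: mint; rewrite !inE eqxx !orbT.
- by rewrite (order_anti xy) // mint // !inE eqxx.
- have zy : R z y by apply: mint; rewrite !inE eqxx !orbT.
  by rewrite -(order_anti yz zy).
Qed.

Lemma embedding_order iota x y : embedding iota -> R (iota x) (iota y) = R x y.
Proof.
move=> emb; have [phi phiP] := defR.
have vE : [tuple iota x; iota y] = map_tuple iota [tuple x; y] by apply: val_inj.
have := phiP [tuple iota x; iota y]; rewrite vE => H1.
have H2 := phiP [tuple x; y].
have H3 := qf_holds_embedding phi [tuple x; y] emb.
by apply/idP/idP => H; [apply/H2/H3/H1|apply/H1/H3/H2].
Qed.

(** If [z] were the least element moved down, then [iota z] would be a smaller one, because [iota]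
    preserves the order. *)
Lemma embedding_increasing iota x : embedding iota -> R x (iota x).
Proof.
move=> emb; apply/negP => /negP nRx.
have [z nRz minz] := @order_minimum (fun z => ~~ R z (iota z)) x nRx.
have zi : R (iota z) z by have := order_total z (iota z); rewrite (negPf nRz).
have := minz (iota z); rewrite embedding_order // => /(_ nRz).
by rewrite (negPf nRz).
Qed.

Lemma count_mem_map iota m x : injective iota -> count_mem (iota x) (map iota m) = count_mem x m.
Proof. by move=> inj; rewrite count_map; apply: eq_count => y /=; rewrite inj_eq. Qed.

Lemma word_lt_perm m1 m2 m1' m2' :
  perm_eq m1 m1' -> perm_eq m2 m2' -> (m1 <w m2) = (m1' <w m2').
Proof.
move=> /perm_count_memP e1 /perm_count_memP e2.
apply/word_ltP/word_ltP => -[x lt_x eq_x]; exists x.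
- by rewrite -e1 -e2.
- by move=> y xy nxy; rewrite -e1 -e2 eq_x.
- by rewrite e1 e2.
- by move=> y xy nxy; rewrite e1 e2 eq_x.
Qed.

Lemma word_ltxx m : (m <w m) = false.
Proof. by apply/negP => /word_ltP[x]; rewrite ltnn. Qed.

Lemma word_lt_trans m2 m1 m3 : m1 <w m2 -> m2 <w m3 -> m1 <w m3.
Proof.
case/word_ltP=> x lt_x eq_x /word_ltP[y lt_y eq_y].
have [xy|nxy] := eqVneq x y.
  subst y; apply/word_ltP; exists x; first exact: ltn_trans lt_y.
  by move=> z xz nxz; rewrite eq_x ?eq_y.
case/orP: (order_total x y) => [xy|yx].
  apply/word_ltP; exists y; first by rewrite eq_x.
  move=> z yz nyz; rewrite eq_x ?eq_y ?(order_trans xy) //.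
  by apply: contraNneq nxy => xz; rewrite -xz in yz; rewrite (order_anti xy yz).
apply/word_ltP; exists x; first by rewrite -eq_y // eq_sym.
move=> z xz nxz; rewrite eq_x ?eq_y ?(order_trans yx) //.
by apply: contraNneq nxy => yz; rewrite -yz in xz; rewrite (order_anti xz yx).
Qed.

(** Only finitely many letters occur, so if the words are not permutations of each other there is a
    largest letter at which the multiplicities differ, and it decides. *)
Lemma word_lt_total m m' : [\/ perm_eq m m', m <w m' | m' <w m].
Proof.
have [eq_mm'|neq_mm'] := boolP (perm_eq m m'); first by constructor 1.
pose P x := count_mem x m != count_mem x m'.
have [x Px maxx] : exists2 x, P x & forall y, P y -> R y x.
  have : has P (m ++ m') by rewrite -[has _ _]negbK has_predC negbK.
  case/hasP => x0 _ Px0.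
  have [x xs /andP[Px maxx]] : exists2 x, x \in m ++ m' &
      P x && all (fun y => P y ==> R y x) (m ++ m').
    have : has P (m ++ m').
      apply/hasP; exists x0 => //; rewrite mem_cat; apply: contraNT Px0.
      by rewrite negb_or => /andP[/count_memPn-> /count_memPn->].
    elim: (m ++ m') => //= y s IHs; have [Ps|nPs] := boolP (has P s).
      move=> _; have [x xs /andP[Px /allP allx]] := IHs Ps.
      have [/andP[Py Rxy]|nyx] := boolP (P y && R x y).
        exists y; rewrite ?mem_head // Py order_refl implybT /=.
        by apply/allP => z zs; apply/implyP => Pz; apply: order_trans Rxy; apply: (implyP (allx z zs)).
      exists x; rewrite ?inE ?xs ?orbT // Px /=; apply/andP; split; last exact/allP.
      apply/implyP => Py; have := order_total y x; rewrite Py /= in nyx.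
      by rewrite (negPf nyx) orbF.
    rewrite orbF => Py; exists y; rewrite ?mem_head // Py order_refl implybT /=.
    apply/allP => z zs; apply/implyP => Pz; case/hasP: nPs; by exists z.
  exists x => // y Py; have [yin|ynin] := boolP (y \in m ++ m').
    exact: implyP (allP maxx y yin) Py.
  move: ynin Py; rewrite mem_cat negb_or /P => /andP[/count_memPn-> /count_memPn->].
  by rewrite eqxx.
have eqx y : R x y -> x != y -> count_mem y m = count_mem y m'.
  move=> xy nxy; apply/eqP; apply: contraNT nxy => Py; apply/eqP/order_anti => //.
  exact: maxx.
case: (ltngtP (count_mem x m) (count_mem x m')) => [lt|gt|eq].
- by constructor 2; apply/word_ltP; exists x.
- by constructor 3; apply/word_ltP; exists x => // y xy nxy; rewrite eqx.
- by move: Px; rewrite /P eq eqxx.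
Qed.

(** If [x] decides the comparison of [m] and [m'], then [iota x] decides that of the images: letters
    outside the image of [iota] have on both sides the multiplicity they have in [a]. The converse
    follows by totality. *)
Lemma word_lt_act iota a m m' :
  embedding iota -> (a ++ map iota m <w a ++ map iota m') = (m <w m').
Proof.
move=> emb; have [inj _] := emb.
have half m1 m2 : m1 <w m2 -> a ++ map iota m1 <w a ++ map iota m2.
  case/word_ltP => x lt_x eq_x; apply/word_ltP; exists (iota x).
    by rewrite !count_cat !count_mem_map // ltn_add2l.
  move=> y xy nxy; rewrite !count_cat; congr (_ + _).
  have [[z yz]|noz] := pselect (exists z, y = iota z).
    rewrite yz !count_mem_map // eq_x //; first by rewrite -(embedding_order _ _ emb) -yz.
    by apply: contraNneq nxy => ->; rewrite yz.
  have notin s : y \notin map iota s by apply/mapP => -[z _ yz]; apply: noz; exists z.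
  by rewrite !(count_memPn (notin _)).
apply/idP/idP => [lt|]; last exact: half.
case: (word_lt_total m m') => [/perm_count_memP eq|//|/half gt].
  move: lt; rewrite (@word_lt_perm _ _ (a ++ map iota m') (a ++ map iota m')) ?word_ltxx //.
  by rewrite perm_cat2l perm_map //; apply/perm_count_memP.
by have := word_lt_trans lt gt; rewrite word_ltxx.
Qed.

(* If [w <w m] at the letter [x], then [w] has fewer letters above [x] than   *)
(* [m]; but an embedding never moves a letter down.                           *)
Lemma word_le_act iota a m : embedding iota -> (a ++ map iota m <w m) = false.
Proof.
move=> emb; apply/negP => /word_ltP[x lt_x eq_x].
set w := a ++ map iota m in lt_x eq_x.
have above s : count (R x) s = count_mem x s + count (predD1 (R x) x) s.
  rewrite -(count_predUI (pred1 x)) (@eq_count _ _ (R x)); last first.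
    by move=> y /=; case: eqP => [->|] //=; rewrite order_refl.
  rewrite (@eq_count _ (predI _ _) pred0) ?count_pred0 ?addn0 // => y /=.
  by case: eqP.
have : perm_eq (filter (predD1 (R x) x) w) (filter (predD1 (R x) x) m).
  apply/perm_count_memP => y; rewrite !count_filter.
  have [/andP[nxy xy]|ny] := boolP (predD1 (R x) x y).
    have e s : count (predI (pred1 y) (predD1 (R x) x)) s = count_mem y s.
      by apply: eq_count => z /=; case: eqP => //= ->; rewrite nxy xy.
    by rewrite !e eq_x // eq_sym.
  have e s : count (predI (pred1 y) (predD1 (R x) x)) s = 0.
    rewrite (@eq_count _ _ pred0) ?count_pred0 // => z /=.
    by case: eqP => //= ->; apply: negPf.
  by rewrite !e.
move/perm_size; rewrite !size_filter => eq_above.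
have : count (R x) w < count (R x) m by rewrite !above eq_above ltn_add2r.
rewrite ltnNge /w count_cat count_map => /negP; apply.
rewrite (leq_trans _ (leq_addl _ _)) //; apply: sub_count => y xy /=.
exact/(order_trans xy)/embedding_increasing.
Qed.

End WordOrder.

(** * Dickson's lemma up to embedding and well-foundedness *)

Section WellQuasiOrder.

Variable A : rel_structure.
Hypothesis wqoA : omega_well_structured A.
Implicit Types (m w : seq A) (iota : A -> A).

Definition word_embeds w m :=
  exists2 iota, embedding iota & forall x, count_mem x w <= count_mem (iota x) m.

Definition word_labelling w : {fmap A -> nat} :=
  [fmap x : seq_fset tt w => count_mem (val x) w]%fmap.

Lemma word_labellingE w x :
  (word_labelling w).[? x]%fmap = if x \in w then Some (count_mem x w) else None.
Proof.
case: fndP => [xw|]; last by rewrite seq_fsetE => /negPf->.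
by rewrite ffunE /=; rewrite seq_fsetE in xw; rewrite xw.
Qed.

Lemma word_embeds_wqo (s : nat -> seq A) :
  exists i j, i < j /\ word_embeds (s i) (s j).
Proof.
have [_ /(_ (fun n => word_labelling (s n)))[i [j [lt_ij [iota emb le]]]]] := wqoA.
exists i, j; split=> //; exists iota => // x.
have [xs|/count_memPn->//] := boolP (x \in s i).
have [|n'] := le x (count_mem x (s i)); first by rewrite word_labellingE xs.
by rewrite word_labellingE; case: ifP => // _ [<-].
Qed.

(** Injectivity preserves multiplicities, so the renamed [w] divides [m], and [a] is the
    quotient. *)
Lemma word_embeds_act w m :
  word_embeds w m -> exists a iota, embedding iota /\ perm_eq m (a ++ map iota w).
Proof.
case=> iota emb le; exists (word_diff m (map iota w)), iota; split=> //.
have [inj _] := emb; apply/perm_count_memP => y.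
rewrite count_cat count_mem_word_diff subnK //.
have [[x yx]|noz] := pselect (exists x, y = iota x); first by rewrite yx count_mem_map.
suff /count_memPn-> : y \notin map iota w by [].
by apply/mapP => -[z _ yz]; apply: noz; exists z.
Qed.

(** Otherwise one could forever choose a further element of [Q] into which no earlier choice embeds,
    against the well quasi order. *)
Lemma finite_basis (Q : seq A -> Prop) :
  exists2 L : seq (seq A), (forall w, w \in L -> Q w) &
    forall m, Q m -> exists2 w, w \in L & word_embeds w m.
Proof.
apply: contrapT => noL.
have next (L : seq (seq A)) : (forall w, w \in L -> Q w) ->
    exists m, Q m /\ forall w, w \in L -> ~ word_embeds w m.
  move=> LQ; apply: contrapT => nom; apply: noL; exists L => // m Qm.
  apply: contrapT => bad; apply: nom; exists m; split=> // w wL emb.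
  by apply: bad; exists w.
have ch := @boolp.choice (seq (seq A)) (seq A) (fun L m => (forall w, w \in L -> Q w) ->
    Q m /\ forall w, w \in L -> ~ word_embeds w m).
have [|f fP] := ch.
  move=> L; have [LQ|nLQ] := pselect (forall w, w \in L -> Q w); last by exists [::].
  by have [m mP] := next L LQ; exists m.
pose Ls n := iter n (fun L => f L :: L) [::].
have LsQ n w : w \in Ls n -> Q w.
  elim: n w => [//|n IHn] w; rewrite inE => /orP[/eqP->|/IHn//].
  by have [] := fP _ IHn.
have LsM i j : i < j -> f (Ls i) \in Ls j.
  elim: j => // j IHj; rewrite ltnS leq_eqVlt inE => /orP[/eqP->|/IHj->].
    by rewrite eqxx.
  by rewrite orbT.
have [i [j [lt_ij]]] := word_embeds_wqo (fun n => f (Ls n)).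
by have [_] := fP _ (LsQ j); apply; apply: LsM.
Qed.

Section Consequences.

Variable R : rel A.
Hypotheses (woR : well_order R)
  (defR : definable (fun v : 2.-tuple A => R (tnth v ord0) (tnth v ord_max))).

(** A least word of a finite basis is least in [Q]: each member of [Q] is a multiple of a renamed
    basis word, so by [word_le_act] it does not lie below that word. *)
Lemma word_lt_minimum (Q : seq A -> Prop) m :
  Q m -> exists2 w, Q w & forall m', Q m' -> ~~ word_lt R m' w.
Proof.
move=> Qm; have [L LQ basisL] := finite_basis Q.
have [w wL minw] : exists2 w, w \in L & forall w', w' \in L -> ~~ word_lt R w' w.
  have [w0 w0L _] := basisL m Qm.
  elim: L w0 w0L {LQ basisL} => // w L IHL w0 _.
  case: L IHL => [|w1 L] IHL.
    by exists w; rewrite ?mem_head // => w'; rewrite inE => /eqP->; rewrite word_ltxx.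
  have [v vL minv] := IHL w1 (mem_head _ _).
  have [wv|wv] := boolP (word_lt R w v).
    exists w; rewrite ?mem_head // => w'; rewrite inE => /orP[/eqP->|/minv].
      by rewrite word_ltxx.
    by apply: contra => w'w; apply: (word_lt_trans woR) wv.
  exists v; first by rewrite inE vL orbT.
  by move=> w'; rewrite inE => /orP[/eqP->|/minv].
exists w; first exact: LQ.
move=> m' /basisL[w' w'L /word_embeds_act[a [iota [emb m'E]]]].
apply: contra (minw w' w'L) => m'w.
case: (word_lt_total woR w' m') => [eq|lt|gt].
- by rewrite (word_lt_perm _ eq (perm_refl w)).
- exact: (word_lt_trans woR) m'w.
- have := word_le_act woR defR a w' emb.
  by rewrite (word_lt_perm _ (_ : perm_eq _ m') (perm_refl w')) ?gt // perm_sym.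
Qed.

Lemma word_lt_wf : well_founded (word_lt R).
Proof.
move=> m; apply: contrapT => nAcc.
have [w nw minw] := @word_lt_minimum (fun m => ~ Acc (word_lt R) m) m nAcc.
apply: nw; constructor => m' m'w; apply: contrapT => /minw.
by rewrite m'w.
Qed.

(* There are finitely many pairs [x < y] up to embedding, and embeddings      *)
(* preserve the order: [x < y] can be tested by comparing with those pairs.   *)
Lemma strict_order_basis :
  exists2 L : seq (A * A), (forall p, p \in L -> p.1 != p.2) &
    forall x y, x != y -> R x y = `[< exists2 p, p \in L & in_emb [:: p.1; p.2] [:: x; y] >].
Proof.
(* Doubling [y] tells the two letters apart: a letter of multiplicity 2 must go to one of
   multiplicity at least 2, so an embedding between such words respects the order of the pair. *)
have [L LQ basisL] := finite_basis
  (fun w => exists x y, [/\ x != y, R x y & w = [:: x; y; y]]).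
case: L LQ basisL => [|w0 L0] LQ basisL.
  exists [::] => // x y nxy; apply/idP/asboolP => [Rxy|[p] //].
  by have [|? //] := basisL [:: x; y; y]; exists x, y.
have [a0 _] := LQ w0 (mem_head _ _); set L := w0 :: L0 in LQ basisL.
pose pr w := (nth a0 w 0, nth a0 w 1).
exists [seq pr w | w <- L].
  by move=> p /mapP[w /LQ[x [y [nxy _ ->]]] ->].
move=> x y nxy; apply/idP/asboolP => [Rxy|[p /mapP[w /LQ[x' [y' [_ Rx'y' ->]]] ->]]].
  have [|w wL [iota emb le]] := basisL [:: x; y; y]; first by exists x, y.
  exists (pr w); first exact: map_f.
  have [x' [y' [nx'y' Rx'y' wE]]] := LQ w wL; exists iota => //.
  have [inj _] := emb.
  have ny'x' : (y' == x') = false by rewrite eq_sym (negPf nx'y').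
  move: (le x') (le y'); rewrite wE /= !eqxx (negPf nx'y') ny'x' => le1 le2.
  have y'y : y = iota y'.
    by move: le2; case: (eqVneq y (iota y')) => // _; case: eqP.
  move: le1; rewrite y'y (inj_eq inj) ny'x'; case: eqP => // xx' _.
  by rewrite xx'.
case=> iota emb [-> ->]; by rewrite (embedding_order defR).
Qed.

End Consequences.

End WellQuasiOrder.

(** * Equivariant Groebner bases *)

Local Open Scope ring_scope.

Section Polynomials.

Variables (K : fieldType) (T : eqType).
Implicit Types (p q : seq (K * seq T)) (m a : seq T) (f : T -> T).

Definition pcoef p m : K :=
  foldr (fun t c => if perm_eq t.2 m then t.1 + c else c) 0 p.

Definition peq p q := forall m, pcoef p m = pcoef q m.

(** The product of the term with coefficient [c] and monomial [a] with the polynomial [p] renamed by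
    [f]: the general building block of an equivariant ideal. *)
Definition act (c : K) a f p := [seq (c * t.1, a ++ map f t.2) | t <- p].

Lemma pcoef_perm p m m' : perm_eq m m' -> pcoef p m = pcoef p m'.
Proof. by move=> /permPr mm'; elim: p => //= t p ->; rewrite mm'. Qed.

Lemma pcoef_cat p q m : pcoef (p ++ q) m = pcoef p m + pcoef q m.
Proof. by elim: p => [|t p /= ->]; rewrite ?add0r //; case: ifP; rewrite ?addrA. Qed.

Lemma pcoef_mem p m : pcoef p m != 0 -> exists2 t, t \in p & perm_eq t.2 m.
Proof.
elim: p => [|t p IHp] /=; first by rewrite eqxx.
case: ifP => [tm _|_ /IHp[u up um]]; first by exists t; rewrite ?mem_head.
by exists u; rewrite ?inE ?up ?orbT.
Qed.

Lemma pcoef_act c a f p m :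
  injective f -> pcoef (act c a f p) (a ++ map f m) = c * pcoef p m.
Proof.
move=> inj; elim: p => [|t p /= ->]; first by rewrite mulr0.
have -> : perm_eq (a ++ map f t.2) (a ++ map f m) = perm_eq t.2 m.
  by rewrite perm_cat2l; apply/idP/idP => [/(perm_map_inj inj)|/perm_map].
by case: ifP => //; rewrite mulrDr.
Qed.

Lemma pcoef_act_neq0 c a f p m : injective f -> pcoef (act c a f p) m != 0 ->
  exists2 m', perm_eq m (a ++ map f m') & pcoef p m' != 0.
Proof.
move=> inj nz; have [_ /mapP[t tp ->] /= tm] := pcoef_mem nz.
exists t.2; first by rewrite perm_sym.
by apply: contraNneq nz => p0; rewrite -(pcoef_perm _ tm) pcoef_act // p0 mulr0.
Qed.

Lemma pcoef_actZ c c' a f p m :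
  pcoef (act (c * c') a f p) m = c * pcoef (act c' a f p) m.
Proof. by elim: p => [|t p /= ->]; rewrite ?mulr0 //; case: ifP; rewrite ?mulrDr ?mulrA. Qed.

Lemma pcoef_act1 c a f p m : pcoef (act c a f p) m = c * pcoef (act 1 a f p) m.
Proof. by rewrite -pcoef_actZ mulr1. Qed.

Lemma pcoef_scale c p m : pcoef (act c [::] id p) m = c * pcoef p m.
Proof. by rewrite -{1}[m]map_id (@pcoef_act c [::]). Qed.

Lemma pcoef_act_perm c a a' f p : perm_eq a a' -> peq (act c a f p) (act c a' f p).
Proof.
move=> aa' m; elim: p => //= t p ->.
by have /permPl-> : perm_eq (a ++ map f t.2) (a' ++ map f t.2) by rewrite perm_cat2r.
Qed.

Lemma act_act c a f c' a' f' p :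
  act c a f (act c' a' f' p) = act (c * c') (a ++ map f a') (f \o f') p.
Proof.
by rewrite /act -map_comp; apply: eq_map => t /=; rewrite mulrA map_cat catA -map_comp.
Qed.

Lemma act_cat c a f p q : act c a f (p ++ q) = act c a f p ++ act c a f q.
Proof. exact: map_cat. Qed.

Definition pvars p := undup (flatten [seq t.2 | t <- p]).

Lemma pvars_uniq p : uniq (pvars p).
Proof. exact: undup_uniq. Qed.

Lemma mem_pvars p t x : t \in p -> x \in t.2 -> x \in pvars p.
Proof. by move=> tp xt; rewrite mem_undup; apply/flattenP; exists t.2; rewrite ?map_f. Qed.

Lemma eq_act c a f f' p : {in pvars p, f =1 f'} -> act c a f p = act c a f' p.
Proof.
move=> ff'; apply/eq_in_map => t tp; congr (_, _ ++ _).
by apply/eq_in_map => x xt; apply: ff'; apply: mem_pvars xt.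
Qed.

Section LeadingMonomial.

Variable R : rel T.

(** Terms of a list may cancel, so only words with nonzero total coefficient compete. The zero
    polynomial gets the value [[::]] and then has [lcoef] 0, which serves as the test for zero. *)
Definition lead p : seq T :=
  foldr (fun m a => if word_lt R a m then m else a) [::]
        [seq t.2 | t <- p & pcoef p t.2 != 0].

Definition lcoef p := pcoef p (lead p).

Lemma lead_vars p x : x \in lead p -> x \in pvars p.
Proof.
suff : lead p = [::] \/ exists2 t, t \in p & lead p = t.2.
  by case=> [->//|[t tp ->]]; apply: mem_pvars.
rewrite /lead; have : {subset [seq t <- p | pcoef p t.2 != 0] <= p}.
  by move=> t; rewrite mem_filter => /andP[].
elim: [seq t <- p | _] => [|t s IHs] /=; first by left.
move=> sub; case: ifP => _; last by apply: IHs => u us; apply: sub; rewrite inE us orbT.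
by right; exists t => //; apply: sub; rewrite mem_head.
Qed.

End LeadingMonomial.

End Polynomials.

(** * Combinations with restricted leading monomials and Buchberger's criterion *)

Section Span.

Variables (K : fieldType) (A : rel_structure) (R : rel A).
Hypotheses (wqoA : omega_well_structured A) (woR : well_order R)
  (defR : definable (fun v : 2.-tuple A => R (tnth v ord0) (tnth v ord_max))).

Local Notation "m <w m'" := (word_lt R m m') (at level 70).
Local Notation poly := (seq (K * seq A)).
Local Notation lead := (@lead K A R).
Local Notation lcoef := (@lcoef K A R).
Implicit Types (p q u g : poly) (m a : seq A) (f : A -> A) (G : poly -> Prop) (L : seq A -> Prop).

Lemma word_lt_nil m : (m <w [::]) = false.
Proof. exact: (word_le_act woR defR m [::] (embedding_id A)). Qed.

Lemma lead_max p m : pcoef p m != 0 -> (lead p <w m) = false.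
Proof.
move=> nz; have [t tp tm] := pcoef_mem nz.
rewrite -(word_lt_perm _ (perm_refl _) tm) /lead.
have : t.2 \in [seq t.2 | t <- p & pcoef p t.2 != 0].
  by apply: map_f; rewrite mem_filter tp (pcoef_perm _ tm) nz.
elim: [seq _ | t <- p & _] => //= w s IHs; rewrite inE => /orP[/eqP->|/IHs lt_t].
  by case: ifP => //; rewrite word_ltxx.
case: ifP => // lt_w; apply/negP => wt; have := word_lt_trans woR lt_w wt.
by rewrite lt_t.
Qed.

(** No nonempty word lies below the initial value [[::]], so as soon as one term survives
    cancellation, the maximum is attained at a surviving term. *)
Lemma lcoef_eq0 p : lcoef p = 0 -> forall m, pcoef p m = 0.
Proof.
move=> lc0 m; apply/eqP; apply: contraTT isT => nz.
have {lc0} : ~~ (lcoef p != 0) by rewrite lc0 eqxx.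
apply: contraNN => _.
have [t tp tm] := pcoef_mem nz.
have /mapP[u] : lead p \in [seq t.2 | t <- p & pcoef p t.2 != 0]; last first.
  by rewrite mem_filter => /andP[nzu _] E; rewrite /lcoef E.
have : t.2 \in [seq t.2 | t <- p & pcoef p t.2 != 0].
  by apply: map_f; rewrite mem_filter tp (pcoef_perm _ tm) nz.
rewrite /lead; elim: [seq _ | t <- p & _] t.2 => //= w s IHs w'; case: s IHs => [|w1 s] IHs.
  rewrite inE => /eqP _ /=; case: ifP => [|nw]; first by rewrite mem_head.
  case: w nw => [|x w] // nw; case: (word_lt_total woR [::] (x :: w)) => [/perm_size//||].
    by rewrite nw.
  by rewrite word_lt_nil.
move=> _; have := IHs w1 (mem_head _ _); case: ifP => _ H; rewrite inE ?eqxx //.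
by rewrite H orbT.
Qed.

Lemma lead_unique p m :
  pcoef p m != 0 -> (forall m', m <w m' -> pcoef p m' = 0) -> perm_eq (lead p) m.
Proof.
move=> nz max; case: (word_lt_total woR (lead p) m) => //.
  by rewrite lead_max.
move=> /max lc0; by rewrite (lcoef_eq0 lc0) eqxx in nz.
Qed.

Lemma act_above c a f p m :
  embedding f -> a ++ map f (lead p) <w m -> pcoef (act c a f p) m = 0.
Proof.
move=> emb lt_m; apply/eqP; apply: contraTT lt_m => nz; have [inj _] := emb.
have [m' mE nz'] := pcoef_act_neq0 inj nz.
by rewrite (word_lt_perm _ (perm_refl _) mE) (word_lt_act woR defR) // lead_max.
Qed.

Lemma pcoef_act_lead c a f p : embedding f -> pcoef (act c a f p) (a ++ map f (lead p)) = c * lcoef p.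
Proof. by move=> [inj _]; rewrite pcoef_act. Qed.

(* [L] restricts the leading monomials of the multiples that are summed up.  *)
Inductive mspan G L : poly -> Prop :=
| mspan0 p : (forall m, pcoef p m = 0) -> mspan G L p
| mspanS c a f g p q : G g -> lcoef g != 0 -> embedding f ->
    L (a ++ map f (lead g)) -> mspan G L p -> peq q (act c a f g ++ p) -> mspan G L q.

Definition ideal G := mspan G (fun=> True).

Lemma mspan_peq G L p q : peq p q -> mspan G L p -> mspan G L q.
Proof.
move=> pq Sp; case: Sp pq => [p0 p0E pq|c a f g p0 q0 Gg lcg emb Lg Sp0 q0E pq].
  by apply: mspan0 => m; rewrite -pq p0E.
by apply: (mspanS (c := c) Gg lcg emb Lg Sp0) => m; rewrite -pq q0E.
Qed.

Lemma mspan_cat G L p q : mspan G L p -> mspan G L q -> mspan G L (p ++ q).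
Proof.
move=> Sp Sq; elim: Sp => [p0 p0E|c a f g p0 q0 Gg lcg emb Lg _ IH q0E].
  by apply: mspan_peq Sq => m; rewrite pcoef_cat p0E add0r.
by apply: (mspanS (c := c) Gg lcg emb Lg IH) => m; rewrite !pcoef_cat q0E pcoef_cat addrA.
Qed.

Lemma mspan_mono G G' L L' p :
  (forall g, G g -> G' g) -> (forall m, L m -> L' m) -> mspan G L p -> mspan G' L' p.
Proof.
move=> GG' LL'; elim=> [p0 p0E|c a f g p0 q0 Gg lcg emb Lg _ IH q0E]; first exact: mspan0.
by apply: (mspanS (c := c) _ lcg emb _ IH q0E); [apply: GG'|apply: LL'].
Qed.

Lemma peq_act c a f p q : injective f -> peq p q -> peq (act c a f p) (act c a f q).
Proof.
move=> inj pq m; have [[m' mE]|nom] := pselect (exists m', perm_eq m (a ++ map f m')).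
  by rewrite !(pcoef_perm _ mE) !pcoef_act // pq.
have z r : pcoef (act c a f r) m = 0.
  apply/eqP; apply: contraTT isT => /(pcoef_act_neq0 inj)[m' mE _].
  by case: nom; exists m'.
by rewrite !z.
Qed.

Lemma mspan_act G L L' c a f p : embedding f ->
  (forall m, L m -> L' (a ++ map f m)) -> mspan G L p -> mspan G L' (act c a f p).
Proof.
move=> emb LL'; have [inj _] := emb.
elim=> [p0 p0E|c' a' f' g p0 q0 Gg lcg emb' Lg _ IH q0E].
  by apply: mspan0 => m; apply/eqP; apply: contraTT isT => /(pcoef_act_neq0 inj)[m' _]; rewrite p0E eqxx.
apply: (@mspanS G L' (c * c') (a ++ map f a') (f \o f') g _ _ Gg lcg _ _ IH).
- exact: embedding_comp.
- by have := LL' _ Lg; rewrite map_cat -map_comp catA.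
- by move=> m; rewrite (peq_act c a inj q0E) act_cat act_act.
Qed.

Lemma mspan_gen G L c a f g :
  G g -> embedding f -> (lcoef g != 0 -> L (a ++ map f (lead g))) -> mspan G L (act c a f g).
Proof.
move=> Gg emb Lg; have [lc0|lc0] := eqVneq (lcoef g) 0.
  apply: mspan0 => m; have [inj _] := emb.
  by apply/eqP; apply: contraTT isT => /(pcoef_act_neq0 inj)[m' _]; rewrite lcoef_eq0 ?eqxx.
apply: (@mspanS G L c a f g [::] _ Gg lc0 emb (Lg lc0)); first exact: mspan0.
by move=> m; rewrite cats0.
Qed.

Lemma mem_ideal G g : G g -> ideal G g.
Proof.
move=> Gg; apply: (@mspan_peq _ _ (act 1 [::] id g)).
  by move=> m; rewrite pcoef_scale mul1r.
by apply: mspan_gen => //; apply: embedding_id.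
Qed.

Lemma ideal_trans G G' p : (forall g, G g -> ideal G' g) -> ideal G p -> ideal G' p.
Proof.
move=> GG'; elim=> [p0 p0E|c a f g p0 q0 Gg lcg emb _ _ IH q0E]; first exact: mspan0.
apply: (@mspan_peq _ _ (act c a f g ++ p0)); first by move=> m; rewrite q0E.
by apply: mspan_cat => //; apply: mspan_act (GG' g Gg).
Qed.

Lemma mspan_below G m p x : mspan G (fun m' => m' <w m) p -> ~~ (x <w m) -> pcoef p x = 0.
Proof.
move=> Sp nlt; elim: Sp => [p0 ->//|c a f g p0 q0 Gg lcg emb lt_m _ IH q0E].
rewrite q0E pcoef_cat IH addr0; apply: act_above => //.
case: (word_lt_total woR (a ++ map f (lead g)) x) => // [eq|gt].
  by rewrite -(word_lt_perm _ eq (perm_refl m)) lt_m in nlt.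
by rewrite (word_lt_trans woR gt lt_m) in nlt.
Qed.

(** [m] is the largest leading monomial among the finitely many multiples in the sum. *)
Lemma mspan_bound G L p : mspan G L p ->
  (forall m, pcoef p m = 0) \/
  exists2 m, L m & mspan G (fun m' => ~~ (m <w m')) p.
Proof.
elim=> [p0 p0E|c a f g p0 q0 Gg lcg emb Lg Sp IH q0E]; first by left.
right; set m0 := a ++ map f (lead g) in Lg.
case: IH => [p0E|[m Lm Sm]].
  exists m0 => //; apply: (@mspanS G _ c a f g p0 _ Gg lcg emb) q0E; first by rewrite word_ltxx.
  exact: mspan0.
have [lt|nlt] := boolP (m <w m0).
  exists m0 => //; apply: (@mspanS G _ c a f g p0 _ Gg lcg emb) q0E; first by rewrite word_ltxx.
  by apply: mspan_mono Sm => // m'; apply: contra; apply: (word_lt_trans woR).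
by exists m => //; apply: (@mspanS G _ c a f g p0 _ Gg lcg emb) q0E.
Qed.

(** Buchberger's condition, asked for all common multiples of renamed leading monomials and not only
    for the least ones: this is the form in which cancellations occur inside a sum. *)
Definition spairs_reduce G := forall g g' a f a' f',
  G g -> G g' -> lcoef g != 0 -> lcoef g' != 0 -> embedding f -> embedding f' ->
  perm_eq (a ++ map f (lead g)) (a' ++ map f' (lead g')) ->
  mspan G (fun m => m <w a ++ map f (lead g))
    (act (lcoef g') a f g ++ act (- lcoef g) a' f' g').

Definition reducible G p := exists g a f,
  [/\ G g, lcoef g != 0, embedding f & perm_eq (lead p) (a ++ map f (lead g))].

(* All multiples with leading monomial [m] are proportional modulo multiples *)
(* with smaller leading monomials.                                           *)
Lemma mspan_top G m p : spairs_reduce G -> mspan G (fun m' => ~~ (m <w m')) p ->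
  mspan G (fun m' => m' <w m) p \/
  exists c g a f u, [/\ G g /\ lcoef g != 0, embedding f, perm_eq m (a ++ map f (lead g)),
    c != 0 & mspan G (fun m' => m' <w m) u /\ peq p (act c a f g ++ u)].
Proof.
move=> CR; elim=> [p0 p0E|c a f g p0 q0 Gg lcg emb Lg _ IH q0E].
  by left; apply: mspan0.
case: (word_lt_total woR (a ++ map f (lead g)) m) => [eq|lt|gt]; last by rewrite gt in Lg.
- case: IH => [Sp0|[c0 [g0 [a0 [f0 [u [[Gg0 lcg0] emb0 eq0 nzc0 [Su p0E]]]]]]]].
    have [c0|nzc] := eqVneq c 0.
      left; apply: mspan_peq Sp0 => x.
      by rewrite q0E pcoef_cat pcoef_act1 c0 mul0r add0r.
    by right; exists c, g, a, f, p0; split=> //; rewrite perm_sym.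
  have Ss := CR g g0 a f a0 f0 Gg Gg0 lcg lcg0 emb emb0 (perm_trans eq eq0).
  have {}Ss : mspan G (fun m' => m' <w m) (act (c / lcoef g0) [::] id
      (act (lcoef g0) a f g ++ act (- lcoef g) a0 f0 g0)).
    apply: mspan_act Ss; first exact: embedding_id.
    by move=> m' lt; rewrite /= map_id -(word_lt_perm _ (perm_refl _) eq).
  (* Modulo smaller multiples, the multiple of [g] is [lcoef g / lcoef g0] times that of [g0]; [d]
     collects the total coefficient of the latter. *)
  pose d := c * lcoef g / lcoef g0 + c0.
  have q0E' : peq q0 (act d a0 f0 g0 ++ (act (c / lcoef g0) [::] id
      (act (lcoef g0) a f g ++ act (- lcoef g) a0 f0 g0) ++ u)).
    move=> x; rewrite q0E !pcoef_cat p0E pcoef_cat pcoef_scale pcoef_cat.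
    rewrite (pcoef_act1 c) (pcoef_act1 c0) (pcoef_act1 d) (pcoef_act1 (lcoef g0)).
    rewrite (pcoef_act1 (- lcoef g)) /d.
    move: (pcoef (act 1 a f g) x) (pcoef (act 1 a0 f0 g0) x) (pcoef u x) => y z t.
    by field.
  have [d0|nzd] := eqVneq d 0.
    left; apply: (mspan_peq _ (mspan_cat Ss Su)) => x.
    by rewrite q0E' [RHS]pcoef_cat pcoef_act1 d0 mul0r add0r.
  by right; exists d, g0, a0, f0, (act (c / lcoef g0) [::] id
      (act (lcoef g0) a f g ++ act (- lcoef g) a0 f0 g0) ++ u); split=> //;
     split=> //; apply: mspan_cat.
- case: IH => [Sp0|[c0 [g0 [a0 [f0 [u [Gg0 emb0 eq0 nzc0 [Su p0E]]]]]]]].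
    by left; apply: (mspanS (c := c) Gg lcg emb lt Sp0).
  right; exists c0, g0, a0, f0, (act c a f g ++ u); split=> //; split.
    by apply: (mspanS (c := c) Gg lcg emb lt Su).
  by move=> x; rewrite q0E !pcoef_cat p0E pcoef_cat addrCA.
Qed.

(** Well-founded induction on the bound [m] of a representation of [p]. If the multiples at [m]
    cancel, there is a representation with a smaller bound; otherwise [m] is the leading monomial of
    [p], and it is also that of a multiple of a generator. *)
Theorem spairs_reduce_reducible G p :
  spairs_reduce G -> ideal G p -> lcoef p != 0 -> reducible G p.
Proof.
move=> CR Ip nz; have nz0 : ~ (forall m, pcoef p m = 0).
  by move=> p0; rewrite /lcoef p0 eqxx in nz.
have [//|[m _]] := mspan_bound Ip.
elim/(well_founded_ind (word_lt_wf wqoA woR defR)): m => m IH Sm.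
have [/mspan_bound[//|[m' lt_m' /IH]]|] := mspan_top CR Sm; first exact.
move=> [c [g [a [f [u [[Gg lcg] emb eq nzc [Su pE]]]]]]].
exists g, a, f; split=> //; apply: perm_trans (eq); apply: lead_unique.
  rewrite pE pcoef_cat (mspan_below Su) ?word_ltxx // addr0.
  by rewrite (pcoef_perm _ eq) pcoef_act_lead // mulf_neq0.
move=> m' lt; rewrite pE pcoef_cat act_above //; last first.
  by rewrite -(word_lt_perm _ eq (perm_refl m')).
rewrite (mspan_below Su) ?addr0 //; apply/negP => gt.
by have := word_lt_trans woR lt gt; rewrite word_ltxx.
Qed.

End Span.

(** * Reduction and completion *)

(** Programs see an embedding only through its list of values [s] on a list [B]; when the lengths
    agree, this extends it by the identity. *)
Definition subst (T : eqType) (B s : seq T) x := nth x s (index x B).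

Lemma subst_map (T : eqType) (B : seq T) f x : x \in B -> subst B (map f B) x = f x.
Proof. by move=> xB; rewrite /subst (nth_map x) ?index_mem // nth_index. Qed.

Section Algorithm.

Variables (K : fieldType) (A : eqType) (R : rel A).
Variables (amalgams : seq A -> seq A -> seq (seq A * seq A)) (embeds : seq A -> seq A -> bool).
Local Notation poly := (seq (K * seq A)).
Local Notation lead := (@lead K A R).
Local Notation lcoef := (@lcoef K A R).
Implicit Types (p q h g : poly) (s : seq A * seq A) (E : seq poly).

(** The factor that lifts the renamed leading monomial of [p] to the least common multiple with that
    of [q]; it is empty exactly when the latter divides the former. *)
Definition cofactorl p q s :=
  word_diff (map (subst (pvars q) s.2) (lead q)) (map (subst (pvars p) s.1) (lead p)).

Definition cofactorr p q s :=
  word_diff (map (subst (pvars p) s.1) (lead p)) (map (subst (pvars q) s.2) (lead q)).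

Definition spoly p q s : poly :=
  act (lcoef q) (cofactorl p q s) (subst (pvars p) s.1) p ++
  act (- lcoef p) (cofactorr p q s) (subst (pvars q) s.2) q.

Definition spolys E :=
  flatten [seq flatten [seq [seq spoly p q s | s <- amalgams (pvars p) (pvars q)] | q <- E] | p <- E].

Definition basis_step E := E ++ spolys E.

(* In general [h] itself cannot be reduced, only its image under an embedding *)
(* that some other embedding inverts on the variables of [h].                 *)
Definition reducts E h :=
  flatten [seq [seq spoly h g s | s <- [seq s <- amalgams (pvars h) (pvars g) |
                                        (cofactorl h g s == [::]) && embeds s.1 (pvars h)]]
          | g <- [seq g <- E | lcoef g != 0]].

Definition reduce E h := if lcoef h == 0 then h else head h (reducts E h).

Definition normal E h := (lcoef h == 0) || (reducts E h == [::]).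

End Algorithm.

(** * Correctness of reduction and termination of completion *)

Section Correctness.

Variables (K : fieldType) (A : rel_structure) (R : rel A).
Hypotheses (wqoA : omega_well_structured A) (woR : well_order R)
  (defR : definable (fun v : 2.-tuple A => R (tnth v ord0) (tnth v ord_max))).
Variables (amalgams : seq A -> seq A -> seq (seq A * seq A)) (embeds : seq A -> seq A -> bool).
Hypothesis amalgamsP : forall B B', uniq B -> uniq B' -> emb_pairs_basis B B' (amalgams B B').
Hypothesis embedsP : forall B s, uniq B -> size s = size B -> embeds B s <-> in_emb B s.

Local Notation "m <w m'" := (word_lt R m m') (at level 70).
Local Notation poly := (seq (K * seq A)).
Local Notation lead := (@lead K A R).
Local Notation lcoef := (@lcoef K A R).
Local Notation spoly := (@spoly K A R).
Local Notation cofactorl := (@cofactorl K A R).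
Local Notation cofactorr := (@cofactorr K A R).
Local Notation spolys := (@spolys K A R amalgams).
Local Notation reducts := (@reducts K A R amalgams embeds).
Local Notation reduce := (@reduce K A R amalgams embeds).
Local Notation normal := (@normal K A R amalgams embeds).
Local Notation mspan := (@mspan K A R).
Local Notation ideal := (@ideal K A R).
Local Notation reducible := (@reducible K A R).
Local Notation elems E := (fun p : poly => is_true (p \in E)).
Implicit Types (p q h g : poly) (m a : seq A) (f : A -> A) (G : poly -> Prop) (E : seq poly).

Lemma act_subst c a f p : act c a (subst (pvars p) (map f (pvars p))) p = act c a f p.
Proof. by apply: eq_act => x xp; apply: subst_map. Qed.

Lemma map_subst_lead f p : map (subst (pvars p) (map f (pvars p))) (lead p) = map f (lead p).
Proof. by apply/eq_in_map => x xp; apply/subst_map/(lead_vars xp). Qed.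

Section Pair.

Variables (p q : poly) (r r' : A -> A) (s : seq A * seq A).
Hypotheses (er : embedding r) (er' : embedding r')
  (sp : s.1 = map r (pvars p)) (sq : s.2 = map r' (pvars q)).

Local Notation d := (cofactorl p q s).
Local Notation d' := (cofactorr p q s).

Lemma cofactorlE : d = word_diff (map r' (lead q)) (map r (lead p)).
Proof. by rewrite /cofactorl sp sq !map_subst_lead. Qed.

Lemma cofactorrE : d' = word_diff (map r (lead p)) (map r' (lead q)).
Proof. by rewrite /cofactorr sp sq !map_subst_lead. Qed.

Lemma spolyE : spoly p q s = act (lcoef q) d r p ++ act (- lcoef p) d' r' q.
Proof. by rewrite /spoly sp sq !act_subst. Qed.

Lemma perm_lcm : perm_eq (d ++ map r (lead p)) (d' ++ map r' (lead q)).
Proof.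
apply/perm_count_memP => x; rewrite cofactorlE cofactorrE !count_cat !count_mem_word_diff.
lia.
Qed.

(** Above the least common multiple both summands vanish, and at it the cross-multiplied leading
    coefficients cancel. *)
Lemma lead_spoly_lt : lcoef (spoly p q s) != 0 -> lead (spoly p q s) <w d ++ map r (lead p).
Proof.
apply: contraR => nlt; apply/eqP; rewrite /lcoef; move: (lead _) nlt => x nlt.
rewrite spolyE pcoef_cat.
case: (word_lt_total woR x (d ++ map r (lead p))) => [eq|lt|gt]; last first.
- rewrite !(act_above woR defR) ?addr0 //.
  by rewrite -(word_lt_perm _ perm_lcm (perm_refl x)).
- by rewrite lt in nlt.
rewrite !(pcoef_perm _ eq) pcoef_act_lead // (pcoef_perm _ perm_lcm) pcoef_act_lead //.
by ring.
Qed.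

Lemma spoly_ideal G : ideal G p -> ideal G q -> ideal G (spoly p q s).
Proof.
move=> Ip Iq; rewrite spolyE.
by apply: mspan_cat; [apply: (mspan_act _ er _ Ip)|apply: mspan_act er' _ Iq].
Qed.

End Pair.

Lemma amalgam_embeddings B B' s : uniq B -> uniq B' -> s \in amalgams B B' ->
  exists r r', [/\ embedding r, embedding r', s.1 = map r B & s.2 = map r' B'].
Proof.
move=> uB uB' sF; have [/(_ s sF)[[r er sr] [r' er' sr']] _] := amalgamsP uB uB'.
by exists r, r'.
Qed.

(** By (C2) the renamings [f] and [f'] factor through one embedding [k] and a listed pair. The given
    common multiple is then [b] times the image under [k] of the least one, so the cancelling
    combination is [b] times the image of a listed S-polynomial, and its representation is
    transported along. *)
Lemma spairs_reduce_amalgams G :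
  (forall p q s, G p -> G q -> s \in amalgams (pvars p) (pvars q) ->
     mspan G (fun m => m <w cofactorl p q s ++ map (subst (pvars p) s.1) (lead p)) (spoly p q s)) ->
  @spairs_reduce K A R G.
Proof.
move=> red p q a f a' f' Gp Gq _ _ ef ef' eq_lead.
have [inpairs univ] := amalgamsP (pvars_uniq p) (pvars_uniq q).
have [||k ek [s sF [fk f'k]]] := univ (map f (pvars p)) (map f' (pvars q)).
- by exists f.
- by exists f'.
have [r [r' [er er' sr sr']]] := amalgam_embeddings (pvars_uniq p) (pvars_uniq q) sF.
have {}fk : {in pvars p, f =1 k \o r}.
  by apply/eq_in_map; rewrite fk sr -map_comp.
have {}f'k : {in pvars q, f' =1 k \o r'}.
  by apply/eq_in_map; rewrite f'k sr' -map_comp.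
have lead_f : map f (lead p) = map k (map r (lead p)).
  by rewrite -map_comp; apply/eq_in_map => x xp; apply/fk/(lead_vars xp).
have lead_f' : map f' (lead q) = map k (map r' (lead q)).
  by rewrite -map_comp; apply/eq_in_map => x xp; apply/f'k/(lead_vars xp).
(* [b] is what remains of [a] beyond the image of the cofactor [d]. That [a'] leaves the same
   remainder is checked letter by letter, separately inside and outside the image of [k]. *)
have [kinj _] := ek.
pose d := cofactorl p q s; pose d' := cofactorr p q s; pose b := word_diff a (map k d).
have count_im x : (forall y, x != k y) -> forall w, count_mem x (map k w) = 0%N.
  by move=> nx w; apply/count_memPn/mapP => -[y _ xy]; have := nx y; rewrite xy eqxx.
have counts x : (count_mem x a + count_mem x (map k (map r (lead p))) =
    count_mem x a' + count_mem x (map k (map r' (lead q))))%N.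
  by have /perm_count_memP/(_ x) := eq_lead; rewrite !count_cat lead_f lead_f'.
have aE : perm_eq a (b ++ map k d).
  apply/perm_count_memP => x; rewrite count_cat count_mem_word_diff.
  have [[y xy]|nx] := pselect (exists y, x = k y); last first.
    by rewrite count_im ?subn0 ?addn0 // => y; apply/eqP => xy; apply: nx; exists y.
  have := counts x; rewrite xy !count_mem_map // /d (cofactorlE sr sr') count_mem_word_diff.
  lia.
have a'E : perm_eq a' (b ++ map k d').
  apply/perm_count_memP => x; rewrite count_cat count_mem_word_diff.
  have [[y xy]|nx] := pselect (exists y, x = k y); last first.
    have nx' y : x != k y by apply/eqP => xy; apply: nx; exists y.
    have := counts x; rewrite !count_im //; lia.
  have := counts x; rewrite xy !count_mem_map // /d (cofactorlE sr sr') /d' (cofactorrE sr sr').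
  rewrite !count_mem_word_diff.
  lia.
have := red p q s Gp Gq sF; rewrite {1}sr map_subst_lead (spolyE sr sr') -/d -/d' => Ss.
have {}Ss : mspan G (fun m => m <w a ++ map f (lead p))
    (act 1 b k (act (lcoef q) d r p ++ act (- lcoef p) d' r' q)).
  apply: (mspan_act _ ek _ Ss) => m lt.
  have e : perm_eq (a ++ map f (lead p)) (b ++ map k (d ++ map r (lead p))).
    by rewrite map_cat lead_f catA perm_cat2r.
  by rewrite (word_lt_perm _ (perm_refl _) e) (word_lt_act woR defR).
apply: mspan_peq Ss => m; rewrite act_cat !act_act !mul1r !pcoef_cat.
rewrite -(pcoef_act_perm _ _ _ aE) -(pcoef_act_perm _ _ _ a'E).
by rewrite (eq_act _ _ fk) (eq_act _ _ f'k).
Qed.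

Lemma mem_spolysP E h : h \in spolys E ->
  exists p q s, [/\ p \in E, q \in E, s \in amalgams (pvars p) (pvars q) & h = spoly p q s].
Proof.
case/flattenP => _ /mapP[p pE ->] /flattenP[_ /mapP[q qE ->]] /mapP[s sF ->].
by exists p, q, s.
Qed.

Lemma mem_spolys E p q s : p \in E -> q \in E -> s \in amalgams (pvars p) (pvars q) ->
  spoly p q s \in spolys E.
Proof.
move=> pE qE sF; apply/flattenP; eexists; first by apply/mapP; exists p.
by apply/flattenP; eexists; [by apply/mapP; exists q|apply/mapP; exists s].
Qed.

Lemma spolys_ideal E G h :
  (forall p, p \in E -> ideal G p) -> h \in spolys E -> ideal G h.
Proof.
move=> EG /mem_spolysP[p [q [s [pE qE sF ->]]]].
have [r [r' [er er' sr sr']]] := amalgam_embeddings (pvars_uniq p) (pvars_uniq q) sF.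
by apply: (spoly_ideal er er' sr sr'); apply: EG.
Qed.

Lemma mem_reductsP E h h' : h' \in reducts E h -> exists g s r r' u,
  [/\ g \in E, lcoef g != 0, embedding r /\ embedding r',
      (s.1 = map r (pvars h) /\ s.2 = map r' (pvars g)) /\ cofactorl h g s = [::] &
      (embedding u /\ {in pvars h, u \o r =1 id}) /\ h' = spoly h g s].
Proof.
case/flattenP => _ /mapP[g gE ->] /mapP[s sF ->].
move: gE sF; rewrite !mem_filter => /andP[lcg gE] /andP[/andP[/eqP d0 rev] sF].
have [r [r' [er er' sr sr']]] := amalgam_embeddings (pvars_uniq h) (pvars_uniq g) sF.
have [rinj _] := er; have [||u eu uE] := (iffLR (embedsP _ _)) rev.
- by rewrite sr map_inj_uniq ?pvars_uniq.
- by rewrite sr size_map.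
exists g, s, r, r', u; split=> //; split=> //; split=> //.
by apply/eq_in_map; rewrite map_id {2}uE sr -map_comp.
Qed.

Lemma reducts_ideal E h h' :
  ideal (elems E) h -> h' \in reducts E h -> ideal (elems E) h'.
Proof.
move=> Ih /mem_reductsP[g [s [r [r' [u [gE _ [er er'] [[sr sr'] _] [_ ->]]]]]]].
by apply: (spoly_ideal er er' sr sr') => //; apply: mem_ideal.
Qed.

(* [u] brings the leading monomial of the reduced polynomial back below that *)
(* of [h], and leading monomials can only increase under embeddings.         *)
Lemma reducts_lt h h' u g s r r' :
  embedding r -> embedding r' -> s.1 = map r (pvars h) -> s.2 = map r' (pvars g) ->
  cofactorl h g s = [::] -> embedding u -> {in pvars h, u \o r =1 id} ->
  h' = spoly h g s -> lcoef h' != 0 -> map u (lead h') <w lead h.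
Proof.
move=> er er' sr sr' d0 eu ur -> nz.
have := lead_spoly_lt er er' sr sr' nz; rewrite d0 /=.
rewrite -(word_lt_act woR defR [::] _ _ eu) /= -map_comp.
suff -> : map (u \o r) (lead h) = lead h by [].
by rewrite -[RHS]map_id; apply/eq_in_map => x xh; apply/ur/(lead_vars xh).
Qed.

Lemma reducts_lead_lt E h h' :
  h' \in reducts E h -> lcoef h' != 0 -> lead h' <w lead h.
Proof.
move=> /mem_reductsP[g [s [r [r' [u [_ _ [er er'] [[sr sr'] d0] [[eu ur] h'E]]]]]]] nz.
have lt := reducts_lt er er' sr sr' d0 eu ur h'E nz.
have nlt := word_le_act woR defR [::] (lead h') eu; rewrite /= in nlt.
case: (word_lt_total woR (map u (lead h')) (lead h')) => [eq|lt'|gt].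
- by rewrite -(word_lt_perm _ eq (perm_refl _)).
- by rewrite lt' in nlt.
- exact: (word_lt_trans woR) gt lt.
Qed.

(** Renaming by [u] turns [h'] into [lcoef g] times [h] minus a multiple of [g] whose leading
    monomial is that of [h]. Solving for [h] transports the representation of [h'] without exceeding
    [lead h]. *)
Lemma reducts_span E h h' : h' \in reducts E h ->
  mspan (elems E) (fun m => ~~ (lead h' <w m)) h' -> mspan (elems E) (fun m => ~~ (lead h <w m)) h.
Proof.
move=> /mem_reductsP[g [s [r [r' [u [gE lcg [er er'] [[sr sr'] d0] [[eu ur] h'E]]]]]]] Sh'.
have [uinj _] := eu; pose d' := cofactorr h g s.
have {Sh'} S1 : mspan (elems E) (fun m => ~~ (lead h <w m)) (act (lcoef g)^-1 [::] u h').
  have [lc0|nz] := eqVneq (lcoef h') 0.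
    apply: mspan0 => m; apply/eqP; apply: contraTT isT => /(pcoef_act_neq0 uinj)[m' _].
    by rewrite (lcoef_eq0 woR defR lc0) eqxx.
  have lt := reducts_lt er er' sr sr' d0 eu ur h'E nz.
  apply: (mspan_act _ eu _ Sh') => m; apply: contra => lt_m.
  have := word_lt_trans woR lt lt_m.
  by rewrite (word_lt_act woR defR [::] (lead h') m eu).
have S2 : mspan (elems E) (fun m => ~~ (lead h <w m))
    (act (lcoef h / lcoef g) (map u d') (u \o r') g).
  apply: mspan_gen => //; first exact: embedding_comp.
  move=> _; have := perm_map u (perm_lcm sr sr'); rewrite d0 /= map_cat -!map_comp.
  have -> : map (u \o r) (lead h) = lead h.
    by rewrite -[RHS]map_id; apply/eq_in_map => x xh; apply/ur/(lead_vars xh).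
  by move=> e; rewrite -(word_lt_perm _ (perm_refl _) e) word_ltxx.
apply: mspan_peq (mspan_cat S1 S2) => m.
rewrite h'E (spolyE sr sr') d0 pcoef_cat act_cat pcoef_cat !act_act /= -/d'.
rewrite (eq_act _ _ ur) (pcoef_act1 _ [::]) (pcoef_act1 _ (map u d')) pcoef_scale mul1r.
rewrite [X in _ + X](pcoef_act1 _ (map u d')).
by field.
Qed.

(** Apply (C2) to the identity on the variables of [h] and to [f] on those of [g]: the resulting [k]
    inverts [r], and as [k] is injective, divisibility after applying [k] already holds before. *)
Lemma reducts_neq0 E h : lcoef h != 0 -> reducible (elems E) h -> reducts E h != [::].
Proof.
move=> nzh [g [a [f [gE lcg ef eq_lead]]]].
have [_ univ] := amalgamsP (pvars_uniq h) (pvars_uniq g).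
have [||k ek [s sF [hk fk]]] := univ (map id (pvars h)) (map f (pvars g)).
- by exists id => //; apply: embedding_id.
- by exists f.
have [r [r' [er er' sr sr']]] := amalgam_embeddings (pvars_uniq h) (pvars_uniq g) sF.
have [kinj _] := ek; have [rinj _] := er.
suff : spoly h g s \in reducts E h by apply: contraTneq => ->.
apply/flattenP; eexists; first by apply/mapP; exists g; rewrite ?mem_filter ?lcg.
apply: map_f; rewrite mem_filter sF andbT; apply/andP; split; last first.
  apply/embedsP; rewrite ?sr ?map_inj_uniq ?pvars_uniq ?size_map //.
  by exists k => //; rewrite -[LHS]map_id hk sr.
have lead_h : map k (map r (lead h)) = lead h.
  rewrite -[RHS]map_id -map_comp; apply/eq_in_map => x xh; move: (lead_vars xh).
  by move: x {xh}; apply/eq_in_map; rewrite hk sr -map_comp.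
have lead_g : map k (map r' (lead g)) = map f (lead g).
  rewrite -map_comp; apply/eq_in_map => x xh; move: (lead_vars xh).
  by move: x {xh}; apply/eq_in_map; rewrite fk sr' -map_comp.
(* A word that contains none of its own letters is empty. *)
have : all (fun x => x \notin cofactorl h g s) (cofactorl h g s).
  apply/allP => x _; apply/count_memPn; rewrite (cofactorlE sr sr') count_mem_word_diff.
  apply/eqP; rewrite subn_eq0 -(count_mem_map (map r' _) x kinj) -(count_mem_map (map r _) x kinj).
  have /perm_count_memP/(_ (k x)) := eq_lead.
  by rewrite count_cat -lead_g -{1}lead_h => ->; rewrite leq_addl.
by case: (cofactorl h g s) => //= x w; rewrite mem_head.
Qed.

Lemma reduceP E h : reduce E h = h \/ lcoef h != 0 /\ reduce E h \in reducts E h.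
Proof.
rewrite /reduce; case: eqP => [|/eqP nz]; first by left.
by case: (reducts E h) => [|h' s] /=; [left|right; rewrite mem_head].
Qed.

Lemma iter_reduce_ideal E k h : ideal (elems E) h -> ideal (elems E) (iter k (reduce E) h).
Proof.
move=> Ih; elim: k => //= k IHk; move: (iter k _ h) IHk => {h Ih} h Ih.
by have [->//|[_ /reducts_ideal]] := reduceP E h; apply.
Qed.

Lemma iter_reduce_span E k h : lcoef (iter k (reduce E) h) = 0 ->
  mspan (elems E) (fun m => ~~ (lead h <w m)) h.
Proof.
elim: k h => [|k IHk] h; first by move=> lc0; apply/mspan0/(lcoef_eq0 woR defR).
rewrite iterSr => /IHk; have [->//|[_ /reducts_span]] := reduceP E h; exact.
Qed.

Lemma reduce_normalizes E h : exists k, normal E (iter k (reduce E) h).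
Proof.
have [m] : exists m, m = lead h by exists (lead h).
elim/(well_founded_ind (word_lt_wf wqoA woR defR)): m h => m IH h mE; subst m.
have [nh|] := boolP (normal E h); first by exists 0%N.
rewrite negb_or => /andP[nz red].
have rh : reduce E h \in reducts E h.
  by rewrite /reduce (negPf nz); case: (reducts E h) red => //= h' s; rewrite mem_head.
have [lc0|nz'] := eqVneq (lcoef (reduce E h)) 0.
  by exists 1%N; rewrite /normal /= lc0 eqxx.
have [k nk] := IH _ (reducts_lead_lt rh nz') _ erefl.
by exists k.+1; rewrite iterSr.
Qed.

(** Taking the least sufficient number of steps makes it accessible to minimization. *)
Definition normal_form E h := iter (ex_minn (reduce_normalizes E h)) (reduce E) h.

Lemma normal_form_ideal E h : ideal (elems E) h ->
  (forall p, ideal (elems E) p -> lcoef p != 0 -> reducible (elems E) p) ->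
  lcoef (normal_form E h) = 0.
Proof.
move=> Ih grob; rewrite /normal_form; case: ex_minnP => k nk _.
have Ik := iter_reduce_ideal k Ih; apply/eqP; case/orP: nk => // /eqP no.
apply: contraT => nz; have := reducts_neq0 nz (grob _ Ik nz).
by rewrite no.
Qed.

Lemma normal_form_sound E h : lcoef (normal_form E h) = 0 ->
  mspan (elems E) (fun m => ~~ (lead h <w m)) h.
Proof. exact: iter_reduce_span. Qed.

Section Basis.

Variable B : seq poly.

Local Notation basis n := (iter n (@basis_step K A R amalgams) B).

Lemma basis_mono i j : (i <= j)%N -> {subset basis i <= basis j}.
Proof.
elim: j => [|j IHj]; first by rewrite leqn0 => /eqP->.
rewrite leq_eqVlt => /orP[/eqP->//|/IHj sub] p /sub pj.
by rewrite /= mem_cat pj.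
Qed.

Lemma basis_ideal n p : ideal (elems (basis n)) p <-> ideal (elems B) p.
Proof.
split; last by apply: mspan_mono => // q; apply: (basis_mono (leq0n n)).
elim: n p => // n IHn p; apply: ideal_trans => {p} p /=.
rewrite mem_cat => /orP[pn|pn]; first exact/IHn/mem_ideal.
by apply: spolys_ideal pn => q qn; apply/IHn/mem_ideal.
Qed.

Definition basis_complete n :=
  all (fun h => lcoef (normal_form (basis n) h) == 0) (spolys (basis n)).

(** An S-polynomial that reduces to zero has a representation bounded by its own leading monomial,
    which is strictly below the least common multiple. *)
Lemma basis_complete_reducible n p : basis_complete n ->
  ideal (elems (basis n)) p -> lcoef p != 0 -> reducible (elems (basis n)) p.
Proof.
move=> /allP complete; apply: (spairs_reduce_reducible wqoA woR defR).
apply: spairs_reduce_amalgams => {}p q s pn qn sF.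
have [r [r' [er er' sr sr']]] := amalgam_embeddings (pvars_uniq p) (pvars_uniq q) sF.
have /complete/eqP/normal_form_sound := mem_spolys pn qn sF.
(* The zero S-polynomial is treated apart: its default leading monomial need not lie below the least
   common multiple. *)
have [lc0|nz] := eqVneq (lcoef (spoly p q s)) 0.
  by move=> _; apply/mspan0/(lcoef_eq0 woR defR).
have := lead_spoly_lt er er' sr sr' nz; rewrite [s.1]sr map_subst_lead => lt.
apply: mspan_mono => // m nlt; apply: contraT => nlt'.
case: (word_lt_total woR m (cofactorl p q s ++ map r (lead p))) => [eq|lt'|gt].
- by rewrite (word_lt_perm _ (perm_refl _) eq) lt in nlt.
- by rewrite lt' in nlt'.
- by rewrite (word_lt_trans woR lt gt) in nlt.
Qed.

(* The union of all the bases is closed under S-polynomials, so it satisfies *)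
(* the criterion trivially; finitely many leading monomials suffice.         *)
Lemma basis_complete_exists : exists n, basis_complete n.
Proof.
pose G p := exists n, p \in basis n.
have grobG p : ideal G p -> lcoef p != 0 -> reducible G p.
  apply: (spairs_reduce_reducible wqoA woR defR).
  apply: spairs_reduce_amalgams => {}p q s [i pi] [j qj] sF.
  have [r [r' [er er' sr sr']]] := amalgam_embeddings (pvars_uniq p) (pvars_uniq q) sF.
  have [lc0|nz] := eqVneq (lcoef (spoly p q s)) 0; first exact/mspan0/(lcoef_eq0 woR defR).
  have Gs : G (spoly p q s).
    exists (maxn i j).+1; rewrite /= mem_cat mem_spolys ?orbT //.
      exact: basis_mono (leq_maxl i j) _ pi.
    exact: basis_mono (leq_maxr i j) _ qj.
  have := lead_spoly_lt er er' sr sr' nz; rewrite [s.1]sr map_subst_lead => lt.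
  (* An S-polynomial that belongs to [G] is its own representation. *)
  apply: (@mspan_peq _ _ _ _ _ (act 1 [::] id (spoly p q s))).
    by move=> m; rewrite pcoef_scale mul1r.
  by apply: mspan_gen => //; [exact: embedding_id|rewrite map_id].
have [L LG basisL] := finite_basis wqoA (fun m => exists p, [/\ G p, lcoef p != 0 & m = lead p]).
have [n Ln] : exists n, forall m, m \in L -> exists p, [/\ p \in basis n, lcoef p != 0 & m = lead p].
  elim: L LG {basisL} => [|m L IHL] LG; first by exists 0%N.
  have [|n Ln] := IHL; first by move=> m' m'L; apply: LG; rewrite inE m'L orbT.
  have [p [[i pi] nz mE]] := LG m (mem_head _ _).
  exists (maxn i n) => m'; rewrite inE => /orP[/eqP->|/Ln[q [qn nzq m'E]]].
    by exists p; split=> //; apply: basis_mono (leq_maxl i n) _ pi.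
  by exists q; split=> //; apply: basis_mono (leq_maxr i n) _ qn.
exists n; apply/allP => h hS; apply/eqP; apply: normal_form_ideal.
  by apply: spolys_ideal hS => p; apply: mem_ideal.
move=> p Ip nz; have [|g [a [f [Gg lcg ef eq_lead]]]] := grobG p _ nz.
  by apply: mspan_mono Ip => // q qn; exists n.
(* The divisor [g] may come from a later stage; it is replaced by an element [q] of stage [n] whose
   renamed leading monomial divides that of [g]. *)
have [|m mL /word_embeds_act[a' [f' [ef' eq']]]] := basisL (lead g); first by exists g.
have [q [qn nzq mE]] := Ln m mL.
exists q, (a ++ map f a'), (f \o f'); split=> //; first exact: embedding_comp.
apply: (perm_trans eq_lead); rewrite map_comp -catA -map_cat perm_cat2l -mE.
exact: perm_map.
Qed.

Definition complete_index := ex_minn basis_complete_exists.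

Theorem ideal_normal_form h :
  ideal (elems B) h <-> lcoef (normal_form (basis complete_index) h) == 0.
Proof.
rewrite /complete_index; case: ex_minnP => n complete _.
rewrite -(basis_ideal n); split=> [Ih|/eqP/normal_form_sound]; last first.
  exact: mspan_mono.
apply/eqP/normal_form_ideal => // p; exact: basis_complete_reducible.
Qed.

End Basis.

End Correctness.

(** * Words and the monoid algebra *)

Section MonoidAlgebra.

Variables (I : choiceType) (K : fieldType).
Local Notation polyring := {malg K[{cmonom I}]}.
Implicit Types (p q : seq (K * seq I)) (s t : seq I).

Definition word_monom s : {cmonom I} := foldr (fun x m => mmul (ucm x) m) mone s.

Lemma word_monomE s x : word_monom s x = count_mem x s.
Proof. by elim: s => [|y s IHs] /=; rewrite ?cm1 // cmM cmU IHs. Qed.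

Lemma word_monom_eq s t : (word_monom s == word_monom t) = perm_eq s t.
Proof.
apply/cmP/perm_count_memP => st x; first by rewrite -!word_monomE st.
by rewrite !word_monomE.
Qed.

Lemma word_monom_cat s t : word_monom (s ++ t) = mmul (word_monom s) (word_monom t).
Proof. by apply/eqP/cmP => x; rewrite cmM !word_monomE count_cat. Qed.

Lemma word_monom_surj (k : {cmonom I}) : exists s, word_monom s = k.
Proof.
exists (flatten [seq nseq (k x) x | x <- finsupp k]).
apply/eqP/cmP => x; rewrite word_monomE count_mem_flatten_nseq ?fset_uniq //.
by case: mdomP => _; rewrite ?muln0 // mul1n.
Qed.

Definition poly_monalg p : polyring := \sum_(t <- p) << t.1 *g word_monom t.2 >>.

Lemma poly_monalg_coef p s : (poly_monalg p)@_(word_monom s) = pcoef p s.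
Proof.
rewrite /poly_monalg; elim: p => [|t p IHp]; first by rewrite big_nil mcoeff0.
by rewrite big_cons mcoeffD IHp mcoeffU word_monom_eq /=; case: ifP; rewrite ?add0r.
Qed.

Lemma poly_monalg_eqP p q : poly_monalg p = poly_monalg q <-> peq p q.
Proof.
split=> [pq m|pq]; first by rewrite -!poly_monalg_coef pq.
by apply/malgP => k; have [s <-] := word_monom_surj k; rewrite !poly_monalg_coef.
Qed.

Lemma poly_monalg_cat p q : poly_monalg (p ++ q) = poly_monalg p + poly_monalg q.
Proof. exact: big_cat. Qed.

Lemma monomial_mul (c c' : K) s t : << c *g word_monom s >> * << c' *g word_monom t >> =
  << c * c' *g word_monom (s ++ t) >> :> polyring.
Proof. by rewrite monalgUM word_monom_cat. Qed.

Lemma poly_monalg_act c a p :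
  << c *g word_monom a >> * poly_monalg p = poly_monalg (act c a id p).
Proof.
rewrite /poly_monalg mulr_sumr big_map; apply: eq_bigr => t _ /=.
by rewrite monomial_mul map_id.
Qed.

Lemma pvar_expr x e : pvar K x ^+ e = << word_monom (nseq e x) >> :> polyring.
Proof.
elim: e => [|e IHe]; first by rewrite expr0.
by rewrite exprS IHe; apply: monalgUM1.
Qed.

Lemma prod_word_monom (S : Type) (r : seq S) (F : S -> seq I) :
  \prod_(x <- r) << word_monom (F x) >> = << word_monom (flatten (map F r)) >> :> polyring.
Proof.
elim: r => [|x r IHr]; first by rewrite big_nil.
by rewrite big_cons IHr /= word_monom_cat; apply: monalgUM1.
Qed.

(** By additivity one monomial suffices, and its product of powers of renamed variables is the word
    with its letters renamed. *)
Lemma rename_poly_monalg (f : I -> I) p :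
  rename f (poly_monalg p) = poly_monalg (act 1 [::] f p).
Proof.
rewrite /rename; set h := fun m : {cmonom I} => _.
have hE s : h (word_monom s) = << word_monom (map f s) >>.
  rewrite /h; under eq_bigr => x _ do rewrite pvar_expr.
  rewrite prod_word_monom; congr << _ >>; apply/eqP; rewrite word_monom_eq.
  have -> : [seq nseq (word_monom s x) (f x) | x <- finsupp (word_monom s)] =
      map (map f) [seq nseq (word_monom s x) x | x <- finsupp (word_monom s)].
    by rewrite -map_comp; apply: eq_map => x /=; rewrite map_nseq.
  rewrite -map_flatten; apply/perm_map/perm_count_memP => x.
  rewrite count_mem_flatten_nseq ?fset_uniq // -word_monomE.
  by case: mdomP => _; rewrite ?muln0 // mul1n.
pose M := mmap (@malgC {cmonom I} K) h.
have M0 : M 0 = 0 by apply: raddf0.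
have MD : {morph M : x y / x + y} by apply: raddfD.
have MU c s : M << c *g word_monom s >> = << c *g word_monom (map f s) >>.
  by rewrite /M mmapU hE mul_malgC -mul_malgC monalgUM mul1m mulr1.
rewrite -[mmap _ h _]/(M _); move: M M0 MD MU => {h hE} M M0 MD MU.
rewrite (big_morph M MD M0) /poly_monalg big_map; apply: eq_bigr => t _ /=.
by rewrite MU mul1r.
Qed.

Definition words_of (p : seq (K * seq (I * nat))) : seq (K * seq I) :=
  [seq (u.1, flatten [seq nseq xe.2 xe.1 | xe <- u.2]) | u <- p].

Lemma poly_of_words (p : seq (K * seq (I * nat))) : poly_of p = poly_monalg (words_of p).
Proof.
rewrite /poly_of /poly_monalg big_map; apply: eq_bigr => t _ /=.
under eq_bigr => x _ do rewrite pvar_expr.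
by rewrite prod_word_monom -mul_malgC monalgUM mul1m mulr1.
Qed.

Lemma poly_monalg_surj (h : polyring) : exists p, poly_monalg p = h.
Proof. by have [p <-] := poly_of_surj h; exists (words_of p); rewrite poly_of_words. Qed.

End MonoidAlgebra.

Lemma sum_unlift (V : zmodType) (X Y Z : Type) (T : X -> Y -> Z -> V) n
    (xs : 'I_n -> X) (ys : 'I_n -> Y) (zs : 'I_n -> Z) x y z :
  \sum_(i < n.+1) T (oapp xs x (unlift ord0 i)) (oapp ys y (unlift ord0 i))
                    (oapp zs z (unlift ord0 i)) =
  T x y z + \sum_(i < n) T (xs i) (ys i) (zs i).
Proof.
rewrite big_ord_recl unlift_none /=; congr (_ + _).
by apply: eq_bigr => i _; rewrite liftK.
Qed.

(** * Equivariant ideals in terms of lists of words *)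

Section EquivariantIdeal.

Variables (A : rel_structure) (K : fieldType) (R : rel A).
Hypotheses (woR : well_order R)
  (defR : definable (fun v : 2.-tuple A => R (tnth v ord0) (tnth v ord_max))).
Local Notation polyring := {malg K[{cmonom A}]}.

Lemma equivariant_ideal0 (B : polyring -> Prop) : equivariant_ideal B 0.
Proof.
exists 0%N, (fun=> 0), (fun=> 0), (fun _ x => x); split=> [[]|[]|] //.
by rewrite big_ord0.
Qed.

Lemma equivariant_idealD (B : polyring -> Prop) h g iota f :
  B g -> embedding iota -> equivariant_ideal B f ->
  equivariant_ideal B (h * rename iota g + f).
Proof.
move=> Bg emb [n [hs [gs [iotas [Bgs embs ->]]]]].
exists n.+1, (fun i => oapp hs h (unlift ord0 i)), (fun i => oapp gs g (unlift ord0 i)),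
  (fun i => oapp iotas iota (unlift ord0 i)); split=> [i|i|].
- by case: unliftP => [j|] _ /=; [apply: Bgs|].
- by case: unliftP => [j|] _ /=; [apply: embs|].
- exact: esym (sum_unlift (fun h g iota => h * rename iota g) hs gs iotas h g iota).
Qed.

(** Each multiplier is a sum of terms, and a term times a renamed generator is an [act]; conversely
    a term is a special multiplier. *)
Lemma equivariant_idealP (B : seq (seq (K * seq A))) f :
  equivariant_ideal (fun g => exists2 p, p \in B & g = poly_monalg p) (poly_monalg f) <->
  ideal R (fun p => p \in B) f.
Proof.
split=> [[n [hs [gs [iotas [Bgs embs fE]]]]]|].
  suff [q /poly_monalg_eqP qf Iq] : exists2 q, poly_monalg q = poly_monalg f & ideal R (fun p => p \in B) q.
    exact: mspan_peq qf Iq.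
  rewrite fE; apply: (big_ind (fun x => exists2 q, poly_monalg q = x & ideal R _ q)).
  - by exists [::]; [rewrite /poly_monalg big_nil|apply: mspan0].
  - by move=> x y [p <- Ip] [q <- Iq]; exists (p ++ q); [apply: poly_monalg_cat|apply: mspan_cat].
  move=> i _; have [p pB ->] := Bgs i; have [H <-] := poly_monalg_surj (hs i).
  rewrite rename_poly_monalg /poly_monalg big_distrl /= -/(poly_monalg _).
  apply: (big_ind (fun x => exists2 q, poly_monalg q = x & ideal R _ q)).
  - by exists [::]; [rewrite /poly_monalg big_nil|apply: mspan0].
  - by move=> x y [q <- Iq] [q' <- Iq']; exists (q ++ q'); [apply: poly_monalg_cat|apply: mspan_cat].
  move=> t _; exists (act t.1 t.2 id (act 1 [::] (iotas i) p)); first by rewrite -poly_monalg_act.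
  rewrite act_act; apply: (mspan_gen woR defR) => //; exact: embs.
elim=> [p p0|c a g h p q gB _ emb _ _ IH qE].
  have -> : poly_monalg p = poly_monalg [::] by apply/poly_monalg_eqP => m; rewrite p0.
  by rewrite /poly_monalg big_nil; apply: equivariant_ideal0.
have -> : poly_monalg q = << c *g word_monom a >> * rename g (poly_monalg h) + poly_monalg p.
  rewrite rename_poly_monalg poly_monalg_act act_act mulr1 /= cats0 -poly_monalg_cat.
  exact/poly_monalg_eqP.
by apply: equivariant_idealD => //; exists h.
Qed.

End EquivariantIdeal.

Lemma ideal_membP (A : rel_structure) (K : countFieldType) (R : rel A)
    (woR : well_order R)
    (defR : definable (fun v : 2.-tuple A => R (tnth v ord0) (tnth v ord_max))) fB :
  @ideal_memb A K fB <-> ideal R (fun p => p \in map (@words_of _ _) fB.2) (words_of fB.1).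
Proof.
rewrite -(equivariant_idealP woR defR) /ideal_memb poly_of_words.
split=> -[n [hs [gs [iotas [Bgs embs fE]]]]]; exists n, hs, gs, iotas; split=> // i.
  have [p pB ->] := Bgs i; exists (words_of p); [exact: map_f|exact: poly_of_words].
have [_ /mapP[p pB ->] ->] := Bgs i; exists p; rewrite ?poly_of_words //.
Qed.

(** * Computability of the algorithm *)

Section ComputableWords.

Variables (T : countType) (R : rel T).
Hypothesis RP : computable (fun p : T * T => R p.1 p.2).

Section Context.

Variable X : countType.
Implicit Types w m : X -> seq T.

Lemma computable_perm_eq w m :
  computable w -> computable m -> computable (fun x => perm_eq (w x) (m x)).
Proof.
move=> wP mP; apply: (@computable_all _ _ (fun x y => count_mem y (w x) == count_mem y (m x))).
  apply: computable_eq; apply: computable_count_mem; computable_proj.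
    by apply: (computable_comp wP); computable_proj.
  by apply: (computable_comp mP); computable_proj.
exact: computable_cat.
Qed.

Lemma computable_word_diff w m :
  computable w -> computable m -> computable (fun x => word_diff (w x) (m x)).
Proof.
move=> wP mP; apply: computable_flatten.
apply: (@computable_map _ _ _ (fun x y => nseq (count_mem y (w x) - count_mem y (m x)) y)).
  apply: computable_nseq; computable_proj.
  apply: computable_subn; apply: computable_count_mem; computable_proj.
    by apply: (computable_comp wP); computable_proj.
  by apply: (computable_comp mP); computable_proj.
exact: computable_undup.
Qed.

Lemma computable_word_lt w m :
  computable w -> computable m -> computable (fun x => word_lt R (w x) (m x)).
Proof.
move=> wP mP.
apply: (@computable_has _ _ (fun x z => (count_mem z (w x) < count_mem z (m x))%N &&
   all (fun y => R z y && (z != y) ==> (count_mem y (w x) == count_mem y (m x))) (w x ++ m x))) => //.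
apply: computable_andb.
  apply: computable_leq; first apply: computable_succ; apply: computable_count_mem; computable_proj.
    by apply: (computable_comp wP); computable_proj.
  by apply: (computable_comp mP); computable_proj.
apply: (@computable_all _ _ (fun p y => R p.2 y && (p.2 != y) ==>
   (count_mem y (w p.1) == count_mem y (m p.1)))); last first.
  apply: computable_cat; [apply: (computable_comp wP)|apply: (computable_comp mP)]; computable_proj.
apply: computable_implyb.
  apply: computable_andb; first by apply: (computable_comp2 RP); computable_proj.
  by apply/computable_negb/computable_eq; computable_proj.
apply: computable_eq; apply: computable_count_mem; computable_proj.
  by apply: (computable_comp wP); computable_proj.
by apply: (computable_comp mP); computable_proj.
Qed.

End Context.

End ComputableWords.

Section ComputablePolynomials.

Variables (K : countFieldType) (T : countType) (R : rel T).
Hypothesis RP : computable (fun p : T * T => R p.1 p.2).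
Hypothesis addP : computable (fun p : K * K => p.1 + p.2).
Hypothesis oppP : computable (fun x : K => - x).
Hypothesis mulP : computable (fun p : K * K => p.1 * p.2).
Local Notation poly := (seq (K * seq T)).

Lemma computable_pcoef (X : countType) (p : X -> poly) (m : X -> seq T) :
  computable p -> computable m -> computable (fun x => pcoef (p x) (m x)).
Proof.
move=> pP mP; apply: (@computable_foldr _ _ _
  (fun x t c => if perm_eq t.2 (m x) then t.1 + c else c)) => //.
  exact: computable_cst.
apply: computable_if; computable_proj.
  by apply: computable_perm_eq; [|apply: (computable_comp mP)]; computable_proj.
by apply: (computable_comp2 addP); computable_proj.
Qed.

Lemma computable_lead (X : countType) (p : X -> poly) :
  computable p -> computable (fun x => lead R (p x)).
Proof.
move=> pP; apply: (@computable_foldr _ _ _ (fun _ m a => if word_lt R a m then m else a)).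
- exact: computable_cst.
- apply: (@computable_map _ _ _ (fun _ t => t.2)); first by computable_proj.
  apply: (@computable_filter _ _ (fun x t => pcoef (p x) t.2 != 0)) => //.
  apply/computable_negb/computable_eq; last exact: computable_cst.
  by apply: computable_pcoef; [apply: (computable_comp pP)|]; computable_proj.
- apply: computable_if; computable_proj.
  by apply: computable_word_lt => //; computable_proj.
Qed.

Lemma computable_lcoef (X : countType) (p : X -> poly) :
  computable p -> computable (fun x => lcoef R (p x)).
Proof. by move=> pP; apply: computable_pcoef => //; apply: computable_lead. Qed.

Lemma computable_pvars (X : countType) (p : X -> poly) :
  computable p -> computable (fun x => pvars (p x)).
Proof.
move=> pP; apply/computable_undup/computable_flatten.
by apply: (@computable_map _ _ _ (fun _ t => t.2)) => //; computable_proj.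
Qed.

Lemma computable_map_subst (X : countType) (B s w : X -> seq T) :
  computable B -> computable s -> computable w ->
  computable (fun x => map (subst (B x) (s x)) (w x)).
Proof.
move=> BP sP wP; apply: (@computable_map _ _ _ (fun x => subst (B x) (s x))) => //.
apply: computable_nth; computable_proj.
  by apply: (computable_comp sP); computable_proj.
by apply: computable_index; [|apply: (computable_comp BP)]; computable_proj.
Qed.

Lemma computable_act (X : countType) (c : X -> K) (a B s : X -> seq T) (p : X -> poly) :
  computable c -> computable a -> computable B -> computable s -> computable p ->
  computable (fun x => act (c x) (a x) (subst (B x) (s x)) (p x)).
Proof.
move=> cP aP BP sP pP; apply: (@computable_map _ _ _
  (fun x t => (c x * t.1, a x ++ map (subst (B x) (s x)) t.2))) => //.
apply: computable_pair.
  by apply: (computable_comp2 mulP); [apply: (computable_comp cP)|]; computable_proj.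
apply: computable_cat; first by apply: (computable_comp aP); computable_proj.
apply: computable_map_subst; computable_proj.
  by apply: (computable_comp BP); computable_proj.
by apply: (computable_comp sP); computable_proj.
Qed.

Section Context.

Variables (X : countType) (p q : X -> poly) (s : X -> seq T * seq T).
Hypotheses (pP : computable p) (qP : computable q) (sP : computable s).

Lemma computable_cofactorl : computable (fun x => cofactorl R (p x) (q x) (s x)).
Proof.
by apply: computable_word_diff; apply: computable_map_subst; computable_proj => //;
  try apply: computable_pvars => //; apply: computable_lead.
Qed.

Lemma computable_cofactorr : computable (fun x => cofactorr R (p x) (q x) (s x)).
Proof.
by apply: computable_word_diff; apply: computable_map_subst; computable_proj => //;
  try apply: computable_pvars => //; apply: computable_lead.
Qed.

Lemma computable_spoly : computable (fun x => spoly R (p x) (q x) (s x)).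
Proof.
apply: computable_cat; apply: computable_act; computable_proj => //.
- exact: computable_lcoef.
- exact: computable_cofactorl.
- exact: computable_pvars.
- by apply: (computable_comp oppP); apply: computable_lcoef.
- exact: computable_cofactorr.
- exact: computable_pvars.
Qed.

End Context.

Variables (amalgams : seq T -> seq T -> seq (seq T * seq T)) (embeds : seq T -> seq T -> bool).
Hypothesis amalgamsP : computable (fun p : seq T * seq T => amalgams p.1 p.2).
Hypothesis embedsP : computable (fun p : seq T * seq T => embeds p.1 p.2).

Lemma computable_spolys (X : countType) (E : X -> seq poly) :
  computable E -> computable (fun x => spolys R amalgams (E x)).
Proof.
move=> EP; apply: computable_flatten.
apply: (@computable_map _ _ _ (fun x p => flatten [seq [seq spoly R p q s |
  s <- amalgams (pvars p) (pvars q)] | q <- E x])) => //.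
apply: computable_flatten.
apply: (@computable_map _ _ _ (fun y q => [seq spoly R y.2 q s |
  s <- amalgams (pvars y.2) (pvars q)])); last first.
  by apply: (computable_comp EP); computable_proj.
apply: (@computable_map _ _ _ (fun z s => spoly R z.1.2 z.2 s)).
  by apply: computable_spoly; computable_proj.
by apply: (computable_comp2 amalgamsP); apply: computable_pvars; computable_proj.
Qed.

Lemma computable_basis_step (X : countType) (E : X -> seq poly) :
  computable E -> computable (fun x => basis_step R amalgams (E x)).
Proof. by move=> EP; apply: computable_cat => //; apply: computable_spolys. Qed.

Lemma computable_reducts (X : countType) (E : X -> seq poly) (h : X -> poly) :
  computable E -> computable h ->
  computable (fun x => reducts R amalgams embeds (E x) (h x)).
Proof.
move=> EP hP; apply: computable_flatten.
apply: (@computable_map _ _ _ (fun x g => [seq spoly R (h x) g s |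
  s <- [seq s <- amalgams (pvars (h x)) (pvars g) |
         (cofactorl R (h x) g s == [::]) && embeds s.1 (pvars (h x))]])); last first.
  apply: (@computable_filter _ _ (fun _ g => lcoef R g != 0)) => //.
  apply/computable_negb/computable_eq; last exact: computable_cst.
  by apply: computable_lcoef; computable_proj.
have h1P : computable (fun y : X * poly * (seq T * seq T) => h y.1.1).
  by apply: (computable_comp hP); computable_proj.
apply: (@computable_map _ _ _ (fun y s => spoly R (h y.1) y.2 s)).
  by apply: computable_spoly; computable_proj.
apply: (@computable_filter _ _ (fun y s => (cofactorl R (h y.1) y.2 s == [::]) &&
   embeds s.1 (pvars (h y.1)))).
  apply: computable_andb.
    apply: computable_eq; last exact: computable_cst.
    by apply: computable_cofactorl; computable_proj.
  by apply: (computable_comp2 embedsP); [|apply: computable_pvars]; computable_proj.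
apply: (computable_comp2 amalgamsP); apply: computable_pvars; computable_proj.
by apply: (computable_comp hP); computable_proj.
Qed.

Section Reduction.

Variables (X : countType) (E : X -> seq poly) (h : X -> poly).
Hypotheses (EP : computable E) (hP : computable h).

Lemma computable_reduce : computable (fun x => reduce R amalgams embeds (E x) (h x)).
Proof.
apply: computable_if => //; last by apply: computable_head => //; apply: computable_reducts.
by apply: computable_eq; [apply: computable_lcoef|apply: computable_cst].
Qed.

Lemma computable_normal : computable (fun x => normal R amalgams embeds (E x) (h x)).
Proof.
apply: computable_orb; apply: computable_eq; try exact: computable_cst.
  exact: computable_lcoef.
exact: computable_reducts.
Qed.

End Reduction.

End ComputablePolynomials.

Lemma decidable_predP (T : countType) (P : T -> Prop) (b : T -> bool) :
  computable b -> (forall x, P x <-> b x) -> decidable_pred P.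
Proof.
case=> c cP bP; exists c => x _; have := cP x I.
split=> [/bP bx|nPx]; first by rewrite bx in H.
by have : b x = false by [apply/negP => /bP]; move=> bx; rewrite bx in H.
Qed.

(** * Total programs from the computability of the domain *)

Section Domain.

Variable A : rel_structure.

(** Removing duplicates puts every input under the promise of (C2) and changes nothing on
    duplicate-free lists. *)
Definition amalgams_of (F : seq A * seq A -> seq (seq A * seq A)) B B' := F (undup B, undup B').

Lemma amalgams_ofP F B B' :
  (forall B B', uniq B -> uniq B' -> emb_pairs_basis B B' (F (B, B'))) ->
  uniq B -> uniq B' -> emb_pairs_basis B B' (amalgams_of F B B').
Proof. by move=> FP uB uB'; rewrite /amalgams_of !undup_id //; apply: FP. Qed.

Lemma computable_amalgams_of F :
  computable_on (fun BB : seq A * seq A => uniq BB.1 /\ uniq BB.2) F ->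
  computable (fun p : seq A * seq A => amalgams_of F p.1 p.2).
Proof.
move=> FP; have idP := computable_id (seq A * seq A)%type.
have uP := computable_pair (computable_undup (computable_fst idP)) (computable_undup (computable_snd idP)).
by apply: computable_on_total (computable_on_comp FP uP) => x; rewrite !undup_uniq.
Qed.

(** The promise of (C1) is tested before its program is called, so the test is computable on all
    inputs. *)
Definition embeds_test (B s : seq A) :=
  if (undup B == B) && (size s == size B) then `[< in_emb B s >] else false.

Lemma embeds_testP B s : uniq B -> size s = size B -> embeds_test B s <-> in_emb B s.
Proof. by move=> uB sB; rewrite /embeds_test undup_id // sB !eqxx /=; split=> /asboolP. Qed.

Lemma computable_embeds_test :
  emb_decidable A -> computable (fun p : seq A * seq A => embeds_test p.1 p.2).
Proof.
case=> c cP; apply: computable_on_if; last exact: computable_cst.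
  apply: computable_andb; apply: computable_eq.
  - by apply: computable_undup; computable_proj.
  - by computable_proj.
  - by apply: computable_size; computable_proj.
  - by apply: computable_size; computable_proj.
exists c => p /andP[/eqP up /eqP sp]; have [|c1 c0] := cP p.
  by split=> //; rewrite -up undup_uniq.
by case: asboolP => [/c1|/c0].
Qed.

(** The relations of the domain are not assumed decidable one by one, so a defining formula cannot
    be evaluated. The finite list [L] of model pairs is built into the program instead, and (C1)
    tests whether one of them embeds. *)
Lemma computable_order (R : rel A) :
  omega_well_structured A -> well_order R ->
  definable (fun v : 2.-tuple A => R (tnth v ord0) (tnth v ord_max)) ->
  emb_decidable A -> computable (fun p : A * A => R p.1 p.2).
Proof.
move=> wqoA woR defR decA; have [L Lneq LP] := strict_order_basis wqoA defR.
apply: (@eq_computable _ _ (fun p => (p.1 == p.2) ||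
    has (fun q => embeds_test [:: q.1; q.2] [:: p.1; p.2]) L)).
  move=> p; have [->|neq] := eqVneq p.1 p.2; first by rewrite order_refl.
  have test q : q \in L -> embeds_test [:: q.1; q.2] [:: p.1; p.2] <-> in_emb [:: q.1; q.2] [:: p.1; p.2].
    by move=> qL; apply: embeds_testP; rewrite //= inE Lneq.
  by rewrite LP //=; apply/hasP/asboolP => -[q qL /(test q qL) emb]; exists q.
apply: computable_orb; first by apply: computable_eq; computable_proj.
apply: (@computable_has _ _ (fun p q => embeds_test [:: q.1; q.2] [:: p.1; p.2])).
  apply: (computable_comp2 (computable_embeds_test decA)).
    by do 2?[apply: computable_cons]; try exact: computable_cst; computable_proj.
  by do 2?[apply: computable_cons]; try exact: computable_cst; computable_proj.
exact: computable_cst.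
Qed.

End Domain.

Lemma computable_words_of (K : countFieldType) (T X : countType) (p : X -> seq (K * seq (T * nat))) :
  computable p -> computable (fun x => words_of (p x)).
Proof.
move=> pP; apply: (@computable_map _ _ _
  (fun _ u => (u.1, flatten [seq nseq xe.2 xe.1 | xe <- u.2]))) => //.
apply: computable_pair; computable_proj.
apply: computable_flatten.
apply: (@computable_map _ _ _ (fun _ xe => nseq xe.2 xe.1)); last by computable_proj.
by apply: computable_nseq; computable_proj.
Qed.

Theorem theorem7p1 (K : countFieldType) (A : rel_structure) :
  computable_field K ->
  omega_well_structured A -> well_ordered A -> computable_domain A ->
  decidable_pred (@ideal_memb A K).
Proof.
move=> [addP oppP mulP _] wqoA [R woR defR] [decA [F FP Fbasis]].
have RP := computable_order wqoA woR defR decA.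
have amP := computable_amalgams_of FP; have emP := computable_embeds_test decA.
have amS B B' := @amalgams_ofP A F B B' Fbasis.
have emS := @embeds_testP A.
pose nf := @normal_form K A R wqoA woR defR _ _ amS emS.
pose poly := seq (K * seq A).
have nfP (X : countType) (E : X -> seq poly) (h : X -> poly) :
    computable E -> computable h -> computable (fun x => nf (E x) (h x)).
  move=> EP hP.
  (* Stated over a context [Y], since it serves both inside the search for the number of steps and
     after it. *)
  have itP (Y : countType) (n : Y -> nat) (g : Y -> X) : computable n -> computable g ->
      computable (fun y => iter (n y) (reduce R (amalgams_of F) (@embeds_test A) (E (g y))) (h (g y))).
    move=> nP gP; apply: (@computable_iter _ _ _ (fun y => reduce R _ _ (E (g y)))) => //.
      exact: (computable_comp hP gP).
    apply: computable_reduce => //; computable_proj.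
    apply: (computable_comp EP); apply: (computable_comp gP); by computable_proj.
  apply: (itP _ _ id); last exact: computable_id.
  (* The search ends because reduction terminates ([reduce_normalizes]). *)
  apply: (@computable_minimum _ (fun x n => normal R (amalgams_of F) (@embeds_test A) (E x)
      (iter n (reduce R (amalgams_of F) (@embeds_test A) (E x)) (h x)))).
    apply: computable_normal => //; first by apply: (computable_comp EP); computable_proj.
    by apply: (itP _ snd fst); computable_proj.
  by move=> x; case: ex_minnP.
have bP (X : countType) (n : X -> nat) (B : X -> seq poly) : computable n -> computable B ->
    computable (fun x => iter (n x) (basis_step R (amalgams_of F)) (B x)).
  move=> nP BP; apply: (@computable_iter _ _ _ (fun _ => basis_step R (amalgams_of F))) => //.
  by apply: computable_basis_step => //; computable_proj.
pose idx := @complete_index K A R wqoA woR defR _ _ amS emS.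
have idxP (X : countType) (B : X -> seq poly) : computable B -> computable (fun x => idx (B x)).
  move=> BP.
  (* The search ends because some stage passes Buchberger's criterion ([basis_complete_exists]). *)
  apply: (@computable_minimum _ (fun x n => basis_complete wqoA woR defR amS emS (B x) n)).
    apply: (@computable_all _ _ (fun p g =>
      lcoef R (nf (iter p.2 (basis_step R (amalgams_of F)) (B p.1)) g) == 0)).
      apply: computable_eq; last exact: computable_cst.
      apply: computable_lcoef => //; apply: nfP; computable_proj.
      by apply: bP; [|apply: (computable_comp BP)]; computable_proj.
    apply: computable_spolys => //; apply: bP; [|apply: (computable_comp BP)]; by computable_proj.
  by move=> x; rewrite /idx /complete_index; case: ex_minnP.
pose gens (fB : seq (K * seq (A * nat)) * seq (seq (K * seq (A * nat)))) :=
  map (@words_of A K) fB.2.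
apply: (@decidable_predP _ _ (fun fB =>
    lcoef R (nf (iter (idx (gens fB)) (basis_step R (amalgams_of F)) (gens fB)) (words_of fB.1)) == 0)).
  have gP : computable gens.
    apply: (@computable_map _ _ _ (fun _ p => words_of p)); last by computable_proj.
    by apply: computable_words_of; computable_proj.
  apply: computable_eq; last exact: computable_cst.
  apply: computable_lcoef => //; apply: nfP.
    by apply: bP => //; apply: idxP.
  by apply: computable_words_of; computable_proj.
move=> fB; rewrite (ideal_membP woR defR).
exact: (ideal_normal_form wqoA woR defR amS emS).
Qed.
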